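(* Let $G$ be a connected graph of maximum degree $\Delta \geq 3$. If $G \not\cong K_{\Delta+1}$, then $G$ is $\frac{1}{6\Delta}$-flexibly $\Delta$-choosable, and $G$ is also weighted $\frac{1}{2\Delta^4}$-flexibly $\Delta$-choosable.
   Context: Graphs are finite and simple. A list assignment $L$ on $G$ assigns to each vertex $v$ a set $L(v)$ of colors. An $L$-coloring is a proper coloring $\varphi$ of $G$ (adjacent vertices get different colors) with $\varphi(v)\in L(v)$ for every $v\in V(G)$. A request on $G$ with list assignment $L$ is a function $r$ with $\operatorname{dom}(r)\subseteq V(G)$ and $r(v)\in L(v)$ for all $v\in\operatorname{dom}(r)$. For $\varepsilon>0$, $r$ is $\varepsilon$-satisfiable if there is an $L$-coloring $\varphi$ of $G$ such that $\varphi(v)=r(v)$ for at least $\varepsilon|\operatorname{dom}(r)|$ vertices $v\in\operatorname{dom}(r)$. $G$ is $\varepsilon$-flexible with respect to $L$ if every request on $G$ is $\varepsilon$-satisfiable. A weighted request is a function $w$ assigning a non-negative real number $w(v,c)$ to each pair $(v,c)$ with $v\in V(G)$, $c\in L(v)$. It is $\varepsilon$-satisfiable if there is an $L$-coloring $\varphi$ of $G$ with $\sum_{v\in V(G)} w(v,\varphi(v))\ge \varepsilon\sum_{v\in V(G),\,c\in L(v)} w(v,c)$. $G$ is weighted $\varepsilon$-flexible with respect to $L$ if every weighted request is $\varepsilon$-satisfiable. $G$ is (weighted) $\varepsilon$-flexibly $k$-choosable if $G$ is (weighted) $\varepsilon$-flexible with respect to every list assignment $L$ with $|L(v)|=k$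 for all $v$. *)

(* Defs.v *)
From HB Require Import structures.
From mathcomp Require Import all_boot all_order all_algebra.
From mathcomp Require Import finmap reals.

Set Implicit Arguments.
Unset Strict Implicit.
Unset Printing Implicit Defensive.

Import Order.TTheory GRing.Theory Num.Theory.

Local Open Scope ring_scope.

Record sgraph := SGraph {
  vertex :> finType;
  adj : rel vertex;
  adj_sym : symmetric adj;
  adj_irr : irreflexive adj }.

Definition degree (G : sgraph) (v : G) : nat := #|[set u | adj v u]|.

Definition max_degree (G : sgraph) : nat := \max_(v : G) degree v.

Definition connected_graph (G : sgraph) : Prop :=
  (0 < #|G|)%N /\ forall u v : G, connect (@adj G) u v.

Definition graph_iso (G H : sgraph) : Prop :=
  exists f : G -> H, bijective f /\ forall u v : G, adj (f u) (f v) = adj u v.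

Lemma neq_sym (n : nat) : symmetric (fun i j : 'I_n => i != j).
Proof. by move=> i j; rewrite eq_sym. Qed.

Lemma neq_irr (n : nat) : irreflexive (fun i j : 'I_n => i != j).
Proof. by move=> i; rewrite eqxx. Qed.

Definition complete_graph (n : nat) : sgraph :=
  SGraph (@neq_sym n) (@neq_irr n).

Definition list_assignment (G : sgraph) (C : choiceType) := G -> {fset C}.

Definition is_coloring (G : sgraph) (C : choiceType)
    (L : list_assignment G C) (phi : G -> C) : Prop :=
  (forall v, phi v \in L v) /\ (forall u v, adj u v -> phi u != phi v).

(* A partial function on the vertices is a total function into [option C],
   whose domain is the set of vertices not sent to [None]. *)
Definition request_dom (G : sgraph) (C : choiceType) (r : G -> option C) : {set G} :=
  [set v | isSome (r v)].

Definition is_request (G : sgraph) (C : choiceType)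
    (L : list_assignment G C) (r : G -> option C) : Prop :=
  forall v c, r v = Some c -> c \in L v.

Definition satisfiable (R : realType) (eps : R) (G : sgraph) (C : choiceType)
    (L : list_assignment G C) (r : G -> option C) : Prop :=
  exists phi : G -> C, is_coloring L phi /\
    eps * #|request_dom r|%:R <= #|[set v in request_dom r | r v == Some (phi v)]|%:R.

Definition flexible (R : realType) (eps : R) (G : sgraph) (C : choiceType)
    (L : list_assignment G C) : Prop :=
  forall r : G -> option C, is_request L r -> satisfiable eps L r.

(* Only the values [w v c] with [c \in L v] are constrained or used. *)
Definition is_weighted_request (R : realType) (G : sgraph) (C : choiceType)
    (L : list_assignment G C) (w : G -> C -> R) : Prop :=
  forall v c, c \in L v -> 0 <= w v c.

Definition weighted_satisfiable (R : realType) (eps : R) (G : sgraph)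
    (C : choiceType) (L : list_assignment G C) (w : G -> C -> R) : Prop :=
  exists phi : G -> C, is_coloring L phi /\
    eps * (\sum_(v : G) \sum_(c <- L v) w v c) <= \sum_(v : G) w v (phi v).

Definition weighted_flexible (R : realType) (eps : R) (G : sgraph)
    (C : choiceType) (L : list_assignment G C) : Prop :=
  forall w : G -> C -> R,
    is_weighted_request L w -> weighted_satisfiable eps L w.

Definition flexibly_choosable (R : realType) (eps : R) (k : nat)
    (G : sgraph) : Prop :=
  forall (C : choiceType) (L : list_assignment G C),
    (forall v, #|` L v| = k) -> flexible eps L.

Definition weighted_flexibly_choosable (R : realType) (eps : R) (k : nat)
    (G : sgraph) : Prop :=
  forall (C : choiceType) (L : list_assignment G C),
    (forall v, #|` L v| = k) -> weighted_flexible eps L.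

(* Main.v *)
(* Call a connected vertex set badable if, for some lists that are at least as large
   as its degrees, it has no colouring from these lists. Greedy colouring shows that such lists
   are tight, so the property passes to connected subsets and makes a set without
   cut vertices regular. With D the maximum degree and the deficit of K the sum of
   D - deg_K(v) over K, splitting at cut vertices shows that a badable set has
   deficit at least D, with equality only for K_1 and K_D, unless it is K_(D+1).
   It also bounds the number of vertices that are cut vertices or have degree 1
   by twice the deficit in excess of D.

   Unweighted requests: take a colouring whose set P of satisfied requests is as
   large as possible. A requested vertex u outside P and without neighbour in P
   cannot be added to P, so some component K_u of G - P - u is badable, and its
   deficit counts the edges from K_u to P and u. Peeling off the largest K_u
   repeatedly shows that there are at most 4 such u per edge leaving P, so the
   number of requests is at most |P| + D|P| + 4D|P| <= 6D|P|.

   Weighted requests: give every vertex its heaviest colour and choose by weight,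
   greedily, a set S of vertices at distance at least 4; this keeps 1/D^4 of the
   weight. Precolouring S fails only on components K of G - S all of whose end
   blocks are owned by single vertices of S, each forming with its block a set
   that is not badable. Two such owners exist and belong to K alone, so
   uncolouring the first owners or the second ones loses at most half the weight,
   and either choice makes the precolouring extendable. *)
Require Import Defs.
From mathcomp Require Import all_boot all_order all_algebra.
From mathcomp Require Import finmap boolp reals.
From mathcomp Require Import zify lra.

Set Implicit Arguments.
Unset Strict Implicit.
Unset Printing Implicit Defensive.

Import Order.TTheory GRing.Theory Num.Theory.

(** * Cardinality and averaging estimates *)

Lemma card_bigcup_le (T : finType) (A : {set T}) (F : T -> {set T}) m :
  (forall a, a \in A -> #|F a| <= m) -> #|\bigcup_(a in A) F a| <= #|A| * m.
Proof.
move=> h; rewrite -sum_nat_const.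
elim/big_rec2: _ => [|a X k aA le]; first by rewrite cards0.
by apply: leq_trans (leq_card_setU _ _) _; apply: leq_add (h a aA) le.
Qed.

Section Sums.
Local Open Scope ring_scope.

(** Since [T1] lies in [S :\: T2], the two remainders together cover [S], so one of them carries at
    least half of its weight. *)
Lemma half_weight (R : realType) (T : finType) (g : T -> R)
    (S T1 T2 : {set T}) : (forall v, 0 <= g v) ->
  T1 \subset S -> [disjoint T1 & T2] ->
  \sum_(v in S) g v <= 2 * \sum_(v in S :\: T1) g v \/
  \sum_(v in S) g v <= 2 * \sum_(v in S :\: T2) g v.
Proof.
move=> g0 T1S dis.
have T1S2 : T1 \subset S :\: T2 by rewrite subsetD T1S.
have le : \sum_(v in T1) g v <= \sum_(v in S :\: T2) g v.
  by rewrite [leRHS](big_setID T1) /= (setIidPr T1S2) lerDl sumr_ge0.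
have : \sum_(v in S) g v <= \sum_(v in S :\: T2) g v + \sum_(v in S :\: T1) g v.
  by rewrite [leLHS](big_setID T1) /= (setIidPr T1S) lerD2r.
set a := \sum_(v in S) _; set b := \sum_(v in _ :\: T2) _; set c := \sum_(v in _) _ => h.
have [bc|cb] := lerP b c; [left|right]; lra.
Qed.

Lemma best_in_seq (R : realType) (T : eqType) (s : seq T)
    (g : T -> R) : s != [::] ->
  exists2 c, c \in s & \sum_(x <- s) g x <= (size s)%:R * g c.
Proof.
elim: s => // x s IH _; have [->|/IH[c cs le]] := eqVneq s [::].
  by exists x; rewrite ?mem_head // big_seq1 mul1r.
have sz : 0 <= (size s)%:R :> R by rewrite ler0n.
rewrite big_cons /= -natr1.
have [xc|cx] := lerP (g x) (g c).
  exists c; first by rewrite inE cs orbT.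
  by nra.
exists x; first exact: mem_head.
by have := ler_wpM2l sz (ltW cx); nra.
Qed.

End Sums.

(** * Connected vertex sets and cut vertices *)

Section Connectivity.
Variable G : sgraph.
Implicit Types (A B K Q X Y : {set G}) (u v x y z : G).

Definition nb v : {set G} := [set u | adj v u].

Definition degin K v := #|nb v :&: K|.

(** A union of components of the graph induced on [X]; together with [conn A] it makes [A] a single
    component. *)
Definition closed_in A X :=
  (A \subset X) && [forall a in A, nb a :&: X \subset A].

(* Without paths: no proper nonempty part of [K] is closed under adjacency. *)
Definition conn K :=
  (K != set0) && [forall A : {set G}, closed_in A K ==> (A == set0) || (A == K)].

Lemma adjC u v : adj u v = adj v u.
Proof. exact: adj_sym. Qed.

Lemma closed_inP A X :
  reflect (A \subset X /\ forall a b, a \in A -> b \in X -> adj a b -> b \in A)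
          (closed_in A X).
Proof.
apply: (iffP andP) => -[AX cl]; split => //.
  move=> a b aA bX ab; move/forall_inP: cl => /(_ a aA)/subsetP; apply.
  by rewrite !inE ab.
apply/forall_inP => a aA; apply/subsetP => b; rewrite !inE => /andP[ab bX].
exact: cl ab.
Qed.

Lemma closed_in_compl A X : closed_in A X -> closed_in (X :\: A) X.
Proof.
case/closed_inP => AX cl; apply/closed_inP; split; first exact: subsetDl.
move=> a b /setDP[aX aA] bX ab; rewrite inE bX andbT.
by apply: contra aA => bA; apply: cl bA aX _; rewrite adjC.
Qed.

Lemma closed_in_trans A B X : closed_in A B -> closed_in B X -> closed_in A X.
Proof.
case/closed_inP => AB clA /closed_inP[BX clB]; apply/closed_inP; split.
  exact: subset_trans BX.
move=> a b aA bX ab; apply: (clA a) => //; apply: (clB a) => //.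
exact: (subsetP AB).
Qed.

Lemma conn_closed K A x : conn K -> closed_in A K -> x \in A -> A = K.
Proof.
case/andP=> _ /forallP/(_ A)/implyP h /h/orP[/eqP->|/eqP//].
by rewrite inE.
Qed.

Lemma conn_intro K x :
  x \in K -> (forall A, closed_in A K -> x \in A -> K \subset A) -> conn K.
Proof.
move=> xK h; apply/andP; split; first by apply/set0Pn; exists x.
apply/forallP => A; apply/implyP => cl.
have AK : A \subset K by case/closed_inP: cl.
have [xA|xA] := boolP (x \in A); apply/orP.
  by right; rewrite eqEsubset AK h.
left; have /subsetP KA : K \subset K :\: A.
  by apply: h; [exact: closed_in_compl | rewrite inE xA].
rewrite -subset0; apply/subsetP => y yA.
by have := KA y (subsetP AK _ yA); rewrite inE yA.
Qed.

Lemma conn_neq0 K : conn K -> exists x, x \in K.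
Proof. by case/andP => /set0Pn. Qed.

Lemma component_exists X x :
  x \in X -> exists A, [/\ closed_in A X, x \in A & conn A].
Proof.
move=> xX; pose Q A := closed_in A X && (x \in A).
have QX : Q X by rewrite /Q xX andbT; apply/closed_inP; split.
case: (arg_minnP (fun A : {set G} => #|A|) QX) => A /andP[clA xA] min.
exists A; split=> //; apply: (conn_intro xA) => B clB xB.
have BA : B \subset A by case/closed_inP: clB.
have := min B; rewrite /Q xB (closed_in_trans clB clA) => /(_ isT) le.
by have /eqP-> : B == A by rewrite eqEcard BA.
Qed.

Lemma conn1 x : conn [set x].
Proof.
apply: (conn_intro (set11 x)) => A _ xA.
by apply/subsetP => y /set1P->.
Qed.

Lemma connU X Y x : conn X -> conn Y -> x \in X -> x \in Y -> conn (X :|: Y).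
Proof.
move=> cX cY xX xY; apply: (@conn_intro _ x); first by rewrite inE xX.
have aux Z A : conn Z -> closed_in A (X :|: Y) -> Z \subset X :|: Y ->
    x \in Z -> x \in A -> Z \subset A.
  move=> cZ /closed_inP[AXY cl] ZXY xZ xA.
  have <- : A :&: Z = Z; last exact: subsetIl.
  apply: (@conn_closed _ _ x cZ); last by rewrite inE xA.
  apply/closed_inP; split; first exact: subsetIr.
  move=> a b /setIP[aA aZ] bZ ab; rewrite inE bZ andbT.
  by apply: (cl a) => //; apply: (subsetP ZXY).
move=> A clA xA; rewrite subUset.
apply/andP; split; apply: (aux _ A) => //.
- exact: subsetUl.
- exact: subsetUr.
Qed.

Lemma connU1 X x b : conn X -> x \in X -> adj x b -> conn (b |: X).
Proof.
move=> cX xX xb.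
have c2 : conn [set x; b].
  apply: (@conn_intro _ x); first by rewrite !inE eqxx.
  move=> A /closed_inP[_ cl] xA; apply/subsetP => y /set2P[->//|->].
  by apply: (cl x) => //; rewrite !inE eqxx orbT.
have := connU cX c2 xX; rewrite !inE eqxx => /(_ isT).
suff -> : X :|: [set x; b] = b |: X by [].
apply/setP => y; rewrite !inE; case: (y =P x) => [->|_]; first by rewrite xX orbT.
by rewrite orbC.
Qed.

Lemma conn_edge K A :
  conn K -> A \subset K -> A != set0 -> A != K ->
  exists a b, [/\ a \in A, b \in K :\: A & adj a b].
Proof.
move=> cK AK /set0Pn[x xA] AnK.
have : ~~ closed_in A K.
  by apply: contra AnK => cl; rewrite (conn_closed cK cl xA).
rewrite /closed_in AK /= => /forall_inPn[a aA /subsetPn[b]].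
rewrite !inE => /andP[ab bK] bA; exists a, b; split=> //.
by rewrite inE bA bK.
Qed.

(** A largest connected proper subset of [K] containing [X] grows along an edge by a vertex [b]; by
    maximality this gives all of [K], so [b] can be removed. *)
Lemma noncut_exists X K :
  conn X -> conn K -> X \subset K -> X != K ->
  exists v, [/\ v \in K, v \notin X & conn (K :\ v)].
Proof.
move=> cX cK XK XnK.
pose Q A := [&& conn A, X \subset A, A \subset K & A != K].
have QX : Q X by apply/and4P.
case: (arg_maxnP (fun A : {set G} => #|A|) QX) => A /and4P[cA XA AK AnK] max.
have A0 : A != set0 by case/andP: cA.
have [a [b [aA /setDP[bK bA] ab]]] := conn_edge cK AK A0 AnK.
have cbA := connU1 cA aA ab.
have bAK : b |: A = K.
  apply/eqP; apply: contraT => ne.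
  have : Q (b |: A).
    apply/and4P; split=> //; first by rewrite (subset_trans XA) ?subsetUr.
    by rewrite subUset AK sub1set bK.
  by move/max; rewrite cardsU1 bA add1n /= ltnn.
exists b; split=> //; first by apply: contra bA => /(subsetP XA).
suff -> : K :\ b = A by [].
by rewrite -bAK setU1K.
Qed.

(* The first disjunct makes the vertex of a singleton a non-cut vertex. *)
Definition noncut K v := (K :\ v == set0) || conn (K :\ v).

Definition nocut K := [forall v in K, noncut K v].

(** A separation at the cut vertex [z]. Keeping [z] on both sides makes each side a connected subset
    of [K], so that badability passes to it and inductions need no block tree. *)
Definition sep K A B z :=
  [/\ [/\ K = A :|: B, A :&: B = [set z] & conn A /\ conn B],
     (1 < #|A|) /\ (1 < #|B|)
   & forall a b, a \in A :\ z -> b \in B :\ z -> ~~ adj a b].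

Lemma sepC K A B z : sep K A B z -> sep K B A z.
Proof.
case=> -[KE IE [cA cB]] [cardA cardB] h.
split; [split; by rewrite 1?setUC 1?setIC | by [] |].
by move=> a b aB bA; rewrite adjC h.
Qed.

Lemma sep_exists K v : conn K -> v \in K -> ~~ noncut K v ->
  exists A B, sep K A B v.
Proof.
move=> cK vK; rewrite negb_or => /andP[/set0Pn[x xK] ncon].
have [A [clA xA cA]] := component_exists xK.
have AK : A \subset K :\ v by case/closed_inP: clA.
have vA : v \notin A by apply/negP => /(subsetP AK); rewrite !inE eqxx.
(* As [K] is connected, each closed part of [K :\ v] has an edge to [v]; hence one component with
   [v], and all the others with [v], form the two connected sides. *)
have link Z : closed_in Z (K :\ v) -> Z != set0 -> exists2 a, a \in Z & adj a v.
  move=> /closed_inP[ZK clZ] Z0.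
  have vZ : v \notin Z by apply/negP => /(subsetP ZK); rewrite !inE eqxx.
  have [||a [b [aZ /setDP[bK bZ] ab]]] := @conn_edge K Z cK _ Z0.
  - by apply: subset_trans ZK _; apply: subsetDl.
  - by apply: contraNneq vZ => ->.
  exists a => //; have [<-//|bv] := eqVneq b v.
  by rewrite (clZ a b) // ?inE ?bv in bZ.
have A0 : A != set0 by apply/set0Pn; exists x.
have [a aA av] := link A clA A0.
have cA' := connU1 cA aA av.
set R := (K :\ v) :\: A.
have R0 : R != set0.
  apply: contra ncon => /eqP; rewrite /R => /eqP; rewrite setD_eq0 => KA.
  suff <- : A = K :\ v by [].
  by apply/eqP; rewrite eqEsubset AK.
have clR : closed_in R (K :\ v) by apply: closed_in_compl.
have vR : v \notin R by rewrite !inE eqxx andbF.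
have cB : conn (v |: R).
  apply: (@conn_intro _ v); first by rewrite setU11.
  move=> Z /closed_inP[ZR clZ] vZ; apply: contraT => nsub.
  have : closed_in (R :\: Z) (K :\ v).
    apply/closed_inP; split; first by rewrite subDset subsetU // /R subsetDl orbT.
    move=> c d /setDP[cR cZ] dK cd.
    have dR : d \in R by case/closed_inP: clR => _; apply; eauto.
    rewrite inE dR andbT; apply: contra cZ => dZ.
    by apply: (clZ d) => //; [rewrite inE cR orbT | rewrite adjC].
  case/link => [|c /setDP[cR cZ] cv].
    apply: contra nsub => /eqP h.
    by rewrite subUset sub1set vZ /= -setD_eq0 h.
  case/negP: cZ; apply: (clZ v) => //; last by rewrite adjC.
  by rewrite inE cR orbT.
exists (v |: A), (v |: R); split.
- split=> //.
    apply/setP => y; rewrite !inE; have [->|_] /= := eqVneq y v; first by rewrite vK.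
    have [/(subsetP AK)|//] := boolP (y \in A).
    by rewrite !inE => /andP[_ ->].
  apply/setP => y; rewrite !inE; have [//|_] /= := eqVneq y v.
  by case: (y \in A) => //=; rewrite andbF.
- rewrite !cardsU1 vA vR; split; rewrite ltnS lt0n cards_eq0 //.
- move=> p q; rewrite !inE.
  have [//|_] := eqVneq p v; have [//|qv] /= := eqVneq q v.
  move=> pA /andP[qA qK]; apply: contra qA => pq.
  by case/closed_inP: clA => _ /(_ p q pA); apply=> //; rewrite !inE qv.
Qed.

Lemma nocut_or_sep K : conn K -> nocut K \/ exists A B z, sep K A B z.
Proof.
move=> cK; have [|] := boolP (nocut K); first by left.
by case/forall_inPn=> v vK /(sep_exists cK vK)[A [B h]]; right; exists A, B, v.
Qed.

Section Sep.
Variables (K A B : {set G}) (z : G).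
Hypothesis hsep : sep K A B z.

Lemma sep_zA : z \in A.
Proof. by case: hsep => -[_ IE _] _ _; have := set11 z; rewrite -IE => /setIP[]. Qed.

Lemma sep_zB : z \in B.
Proof. by case: hsep => -[_ IE _] _ _; have := set11 z; rewrite -IE => /setIP[]. Qed.

Lemma sep_subA : A \subset K.
Proof. by case: hsep => -[-> _ _] _ _; apply: subsetUl. Qed.

Lemma sep_subB : B \subset K.
Proof. by case: hsep => -[-> _ _] _ _; apply: subsetUr. Qed.

Lemma sep_inAB x : x \in A -> x \in B -> x = z.
Proof.
by case: hsep => -[_ IE _] _ _ xA xB; apply/set1P; rewrite -IE inE xA.
Qed.

Lemma sep_card : #|K|.+1 = #|A| + #|B|.
Proof.
case: hsep => -[-> IE _] _ _.
by have := cardsUI A B; rewrite IE cards1; lia.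
Qed.

Lemma sep_cardA : #|A| < #|K|.
Proof. by have := sep_card; case: hsep => _ []; lia. Qed.

Lemma sep_degA x : x \in A -> x != z -> degin K x = degin A x.
Proof.
case: hsep => -[KE IE _] _ h xA xz; rewrite /degin; congr #|pred_of_set _|.
apply/setP => y; rewrite KE !inE; case xy: (adj x y) => //=.
have [//|yA] := boolP (y \in A); apply/negP => yB.
have yz : y != z by apply: contraNneq yA => ->; apply: sep_zA.
rewrite /= in yB.
have := h x y; rewrite !inE xz xA yz yB xy.
by move=> /(_ isT isT).
Qed.

Lemma sep_degz : degin K z = degin A z + degin B z.
Proof.
case: hsep => -[KE IE _] _ h; rewrite /degin KE setIUr cardsU.
suff -> : (nb z :&: A) :&: (nb z :&: B) = set0 by rewrite cards0 subn0.
apply/setP => y; rewrite !inE; apply/negP => /andP[/andP[zy yA] /andP[_ yB]].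
by rewrite (sep_inAB yA yB) adj_irr in zy.
Qed.

End Sep.

Lemma degin_gt0 K v : conn K -> 1 < #|K| -> v \in K -> 0 < degin K v.
Proof.
move=> cK K1 vK.
have [|||a [b [/set1P-> /setDP[bK _] ab]]] := @conn_edge K [set v] cK.
- by rewrite sub1set.
- by apply/set0Pn; exists v; rewrite set11.
- by apply: contraTneq K1 => <-; rewrite cards1.
by rewrite card_gt0; apply/set0Pn; exists b; rewrite !inE ab.
Qed.

Lemma degin_ltA K A B z : sep K A B z -> degin A z < degin K z.
Proof.
move=> h; rewrite (sep_degz h).
case: (h) => -[_ _ [cA cB]] [_ B1] _.
by have := degin_gt0 cB B1 (sep_zB h); lia.
Qed.

Lemma degin_lt_card K v : v \in K -> degin K v < #|K|.
Proof.
move=> vK; apply: proper_card; apply/properP; split; first exact: subsetIr.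
by exists v => //; rewrite !inE adj_irr.
Qed.

Lemma degin_sub K X v : X \subset K -> degin X v <= degin K v.
Proof. by move=> XK; rewrite subset_leq_card // setIS. Qed.

Lemma degin_D1 K v w : v \in K -> degin K w = adj w v + degin (K :\ v) w.
Proof.
move=> vK; rewrite /degin (cardsD1 v) !inE vK andbT.
by congr (_ + #|pred_of_set _|); apply/setP => y; rewrite !inE andbCA.
Qed.

Lemma degin_U1 K v w : v \notin K -> degin (v |: K) w = adj w v + degin K w.
Proof. by move=> vK; rewrite (degin_D1 w (setU11 v K)) setU1K. Qed.

Lemma noncut_conn K v : conn K -> 1 < #|K| -> noncut K v -> conn (K :\ v).
Proof.
move=> cK K1 /orP[|//]; rewrite setD_eq0 => /subset_leq_card.
by rewrite cards1; lia.
Qed.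

Lemma full_adj Q u v :
  u \in Q -> v \in Q -> degin Q u = #|Q|.-1 -> u != v -> adj u v.
Proof.
move=> uQ vQ e uv; have E : nb u :&: Q = Q :\ u.
  apply/eqP; rewrite eqEcard; apply/andP; split; last first.
    by have := cardsD1 u Q; rewrite uQ -/(degin Q u) e; clear; lia.
  apply/subsetP => w; rewrite !inE => /andP[uw ->]; rewrite andbT.
  by apply: contraTneq uw => ->; rewrite adj_irr.
have : v \in Q :\ u by rewrite !inE eq_sym uv.
by rewrite -E !inE => /andP[].
Qed.

Lemma conn_sub_closed X A Y x :
  conn X -> X \subset Y -> closed_in A Y -> x \in X -> x \in A -> X \subset A.
Proof.
move=> cX XY /closed_inP[AY cl] xX xA.
have clX : closed_in (A :&: X) X.
  apply/closed_inP; split; first exact: subsetIr.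
  move=> a b /setIP[aA _] bX ab; rewrite inE bX andbT.
  by apply: (cl a) => //; apply: (subsetP XY).
by rewrite -(conn_closed cX clX (x := x)) ?subsetIl // inE xA.
Qed.

Lemma degin_pos K u v : v \in K -> adj u v -> 0 < degin K u.
Proof. by move=> vK uv; rewrite card_gt0; apply/set0Pn; exists v; rewrite in_setI inE uv. Qed.

End Connectivity.

(** * Colourings from lists as large as the degrees *)

Section ListColouring.
Variables (G : sgraph) (C : choiceType) (c0 : C).
Implicit Types (A B K X : {set G}) (L : G -> {fset C}) (phi : G -> C).

Definition avoid (F : {fset C}) phi (S : {set G}) : {fset C} :=
  (F `\` [fset phi w | w in S])%fset.

Lemma in_avoid F phi S c :
  (c \in avoid F phi S) = (c \in F) && [forall w in S, phi w != c].
Proof.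
rewrite in_fsetD andbC; congr (_ && _); apply/idP/forall_inP => [h w wS|h].
  by apply: contraNneq h => <-; apply/imfsetP; exists w.
apply/negP => /imfsetP[w /= wS e]; by move: (h w wS); rewrite e eqxx.
Qed.

Lemma card_avoid F phi S : #|` F| <= #|` avoid F phi S| + #|S|.
Proof.
rewrite /avoid -(cardfsID [fset phi w | w in S]%fset F) addnC leq_add2l.
apply: leq_trans (fsubset_leq_card (fsubsetIr _ _)) _.
by rewrite (leq_trans (leq_imfset_card _ _ _)) // cardE.
Qed.

Definition colorable K L := exists phi : G -> C,
  (forall v, v \in K -> phi v \in L v) /\
  (forall u v, u \in K -> v \in K -> adj u v -> phi u != phi v).

(** A vertex [v] with slack is coloured last. The slack hypothesis survives its removal: a closed
    part of [K :\ v] is closed in [K] or contains a neighbour of [v], whose degree has dropped. *)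
Lemma greedy K L :
  (forall v, v \in K -> degin K v <= #|` L v|) ->
  (forall A, closed_in A K -> A != set0 ->
     exists2 v, v \in A & degin K v < #|` L v|) ->
  colorable K L.
Proof.
have [n] := ubnP #|K|; elim: n K => // n IH K; rewrite ltnS => leKn degL slack.
have [->|K0] := eqVneq K set0.
  by exists (fun=> c0); split=> [v|u v]; rewrite inE.
have [v vK vslack] : exists2 v, v \in K & degin K v < #|` L v|.
  by apply: slack => //; apply/closed_inP; split.
have [||A clA A0|phi [phiL phiP]] := IH (K :\ v).
- by move: leKn; rewrite (cardsD1 v) vK.
- move=> w; rewrite !inE => /andP[_ wK]; apply: leq_trans (degL _ wK).
  exact/degin_sub/subD1set.
- have AK : A \subset K :\ v by case/closed_inP: clA.
  have AK' := subset_trans AK (subD1set K v).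
  have [nb0|] := boolP [forall a in A, ~~ adj a v].
    have [|w wA ws] := slack A _ A0.
      apply/closed_inP; split=> // a b aA bK ab.
      have [bv|bv] := eqVneq b v.
        by have /forall_inP/(_ a aA) := nb0; rewrite -bv ab.
      by case/closed_inP: clA => _ /(_ a b aA); apply; rewrite // !inE bv.
    exists w => //; apply: leq_ltn_trans ws.
    exact/degin_sub/subD1set.
  case/forall_inPn => a aA; rewrite negbK => av; exists a => //.
  have := degL a (subsetP AK' _ aA).
  by rewrite (degin_D1 a vK) av.
have : 0 < #|` avoid (L v) phi (nb v :&: K)|.
  by have := card_avoid (L v) phi (nb v :&: K); rewrite /degin in vslack; lia.
rewrite cardfs_gt0 => /fset0Pn[c]; rewrite in_avoid => /andP[cL /forall_inP cP].
exists (fun w => if w == v then c else phi w); split=> [w wK|u w uK wK uw].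
  by case: eqVneq => [->//|wv]; apply: phiL; rewrite !inE wv.
have [uv|uv] := eqVneq u v; have [wv|wv] := eqVneq w v.
- by rewrite uv wv adj_irr in uw.
- by rewrite eq_sym cP // !inE wK -uv uw.
- by rewrite cP // !inE uK -wv adjC uw.
- by apply: phiP; rewrite ?inE ?uv ?wv.
Qed.

Definition bad K L :=
  [/\ conn K, forall v, v \in K -> degin K v <= #|` L v| & ~ colorable K L].

(* These are Gallai trees, but no block structure theorem is needed: heredity and
   the regularity of the pieces without cut vertices suffice. *)
Definition badable K := exists L, bad K L.

Lemma badable_conn K : badable K -> conn K.
Proof. by case=> L []. Qed.

Lemma bad_tight K L v : bad K L -> v \in K -> #|` L v| = degin K v.
Proof.
case=> cK degL ncol vK; apply/eqP; rewrite eqn_leq degL // andbT leqNgt.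
apply/negP => h; apply: ncol; apply: greedy => // A clA /set0Pn[x xA].
by exists v => //; rewrite (conn_closed cK clA xA).
Qed.

Definition del_color L v c : G -> {fset C} :=
  fun w => if adj v w then (L w `\ c)%fset else L w.

(** Giving [v] the colour [c] costs each neighbour at most one colour and exactly one degree, and a
    colouring of the rest would extend to [v]. *)
Lemma bad_del K L v c :
  bad K L -> v \in K -> conn (K :\ v) -> c \in L v ->
  bad (K :\ v) (del_color L v c).
Proof.
case=> cK degL ncol vK cKv cL; split=> //.
  move=> w; rewrite !inE => /andP[wv wK]; have := degL w wK.
  rewrite (degin_D1 w vK) /del_color adjC; case: (adj v w) => //=.
  by rewrite (cardfsD1 c (L w)); case: (c \in L w) => /=; lia.
case=> phi [phiL phiP]; apply: ncol.
have phiL' w : w \in K -> w != v -> phi w \in L w /\ (adj v w -> phi w != c).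
  move=> wK wv; have := phiL w; rewrite !inE wv wK => /(_ isT).
  by rewrite /del_color; case: (adj v w) => //; rewrite !inE => /andP[].
exists (fun w => if w == v then c else phi w); split=> [w wK|u w uK wK uw].
  by case: eqVneq => [->//|wv]; case: (phiL' w wK wv).
have [uv|uv] := eqVneq u v; have [wv|wv] := eqVneq w v.
- by rewrite uv wv adj_irr in uw.
- by rewrite eq_sym; case: (phiL' w wK wv) => _; apply; rewrite -uv.
- by case: (phiL' u uK uv) => _; apply; rewrite -wv adjC.
- by apply: phiP; rewrite ?inE ?uv ?wv.
Qed.

(** If [c] were missing from [L w], colouring [v] with [c] would lower the degree of [w] but not its
    list, against [bad_tight]. *)
Lemma bad_sub_nb K L v w :
  bad K L -> v \in K -> conn (K :\ v) -> w \in K -> adj v w ->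
  (L v `<=` L w)%fset.
Proof.
move=> bK vK cKv wK vw; apply/fsubsetP => c cL.
have wv : w != v by apply: contraTneq vw => ->; rewrite adj_irr.
have wKv : w \in K :\ v by rewrite !inE wv.
have := bad_tight (bad_del bK vK cKv cL) wKv.
rewrite /del_color vw => e.
have := bad_tight bK wK; rewrite (degin_D1 w vK) (adjC w) vw.
by rewrite (cardfsD1 c (L w)) e; case: (c \in L w) => //=; lia.
Qed.

Lemma bad_del_exists K L v :
  bad K L -> v \in K -> conn (K :\ v) -> exists L', bad (K :\ v) L'.
Proof.
move=> bK vK cKv; have cK : conn K by case: bK.
have : 0 < #|` L v|.
  rewrite (bad_tight bK vK) degin_gt0 // (cardsD1 v) vK.
  by have [x xK] := conn_neq0 cKv; rewrite (cardsD1 x) xK.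
rewrite cardfs_gt0 => /fset0Pn[c cL].
by exists (del_color L v c); apply: bad_del.
Qed.

Lemma badable_sub K X : badable K -> X \subset K -> conn X -> badable X.
Proof.
have [n] := ubnP #|K|; elim: n K => // n IH K; rewrite ltnS => leKn.
move=> bK XK cX; have [->//|XnK] := eqVneq X K.
have cK := badable_conn bK.
have [v [vK vX cKv]] := noncut_exists cX cK XK XnK.
case: bK => L bL; apply: (IH (K :\ v)) => //.
- by move: leKn; rewrite (cardsD1 v) vK.
- exact: bad_del_exists bL vK cKv.
- apply/subsetP => x xX; rewrite !inE (subsetP XK) // andbT.
  by apply: contraNneq vX => <-.
Qed.

(** Along an edge the inclusion of [bad_sub_nb] holds both ways, and connectedness spreads the
    equality. As the lists are tight, equal lists give equal degrees. *)
Lemma nocut_regular K L u v :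
  bad K L -> nocut K -> u \in K -> v \in K -> L u = L v.
Proof.
move=> bK /forall_inP ncK uK vK; have cK : conn K by case: bK.
have sub x y : x \in K -> y \in K -> adj x y -> (L x `<=` L y)%fset.
  move=> xK yK xy; apply: (bad_sub_nb bK xK) => //; apply: noncut_conn (ncK _ xK) => //.
  rewrite (cardsD1 x) xK (cardsD1 y) !inE yK andbT.
  by case: eqVneq xy => // ->; rewrite adj_irr.
have clA : closed_in [set x in K | L x == L u] K.
  apply/closed_inP; split; first by apply/subsetP => x; rewrite inE => /andP[].
  move=> a b; rewrite !inE => /andP[aK /eqP <-] bK' ab; rewrite bK' /=.
  by rewrite eqEfsubset !sub // adjC.
have uA : u \in [set x in K | L x == L u] by rewrite inE uK eqxx.
have := vK; rewrite -(conn_closed cK clA uA) inE => /andP[_ /eqP->//].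
Qed.

Lemma nocut_degin K : badable K -> nocut K ->
  exists d, forall v, v \in K -> degin K v = d.
Proof.
case=> L bK ncK; have cK : conn K by case: bK.
have [x xK] := conn_neq0 cK; exists (degin K x) => v vK.
by rewrite -!(bad_tight bK) // (nocut_regular bK ncK vK xK).
Qed.

Lemma sep_badable K A B z : badable K -> sep K A B z -> badable A /\ badable B.
Proof.
move=> bK h; have [[KE _ [cA cB]] _ _] := h.
by split; apply: badable_sub bK _ _; rewrite // KE ?subsetUl ?subsetUr.
Qed.

Lemma uncolorable_component X L :
  ~ colorable X L -> exists K, [/\ closed_in K X, conn K & ~ colorable K L].
Proof.
have [n] := ubnP #|X|; elim: n X => // n IH X; rewrite ltnS => leXn ncX.
have clX : closed_in X X by apply/closed_inP; split.
have [cX|] := boolP (conn X); first by exists X.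
rewrite negb_and negbK => /orP[/eqP X0|].
  by case: ncX; exists (fun=> c0); split=> [v|u v]; rewrite X0 inE.
case/forallPn => A; rewrite negb_imply negb_or => /and3P[clA A0 AX].
have AsX : A \subset X by case/closed_inP: clA.
have clB := closed_in_compl clA; set B := X :\: A in clB.
have small Y : closed_in Y X -> Y != X -> #|Y| < n.
  move=> /closed_inP[YX _] ne; apply: leq_trans leXn; apply: proper_card.
  by rewrite properEneq ne.
have [cA|ncA] := pselect (colorable A L); last first.
  have [K [clK cK ncK]] := IH A (small A clA AX) ncA.
  by exists K; split=> //; apply: closed_in_trans clA.
have BX : B != X.
  case/set0Pn: A0 => a aA; apply: contraTneq (subsetP AsX a aA) => <-.
  by rewrite inE aA.
have [cB|ncB] := pselect (colorable B L); last first.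
  have [K [clK cK ncK]] := IH B (small B clB BX) ncB.
  by exists K; split=> //; apply: closed_in_trans clB.
case: ncX; case: cA => f [fL fP]; case: cB => g [gL gP].
have [/closed_inP[_ hA] /closed_inP[_ hB]] := (clA, clB).
exists (fun v => if v \in A then f v else g v); split=> [v vX|u v uX vX uv].
  by case: ifP => vA; [apply: fL | apply: gL; rewrite inE vA].
case: ifP => uA; case: ifP => vA.
- exact: fP.
- by rewrite (hA u v) in vA.
- by rewrite (hA v u) // adjC in uA.
- by apply: gP; rewrite ?inE ?uA ?vA.
Qed.

Definition rest_lists (L : G -> {fset C}) (f : G -> C) (S : {set G}) v :=
  avoid (L v) f (nb v :&: S).

Lemma extend_coloring (L : G -> {fset C}) f (S : {set G}) :
  (forall v, v \in S -> f v \in L v) ->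
  (forall u v, u \in S -> v \in S -> adj u v -> f u != f v) ->
  colorable (~: S) (rest_lists L f S) ->
  exists phi, is_coloring L phi /\ forall v, v \in S -> phi v = f v.
Proof.
move=> fL fP [g [gL gP]].
have gL' v : v \notin S -> g v \in L v /\ forall u, u \in S -> adj v u -> f u != g v.
  rewrite -in_setC => /gL; rewrite in_avoid => /andP[-> /forall_inP h].
  by split=> // u uS vu; apply: h; rewrite !inE vu.
exists (fun v => if v \in S then f v else g v); split; last by move=> v ->.
split=> [v|u v uv].
  by case: ifP => vS; [apply: fL | case: (gL' v (negbT vS))].
case: ifP => uS; case: ifP => vS.
- exact: fP.
- by case: (gL' v (negbT vS)) => _; apply=> //; rewrite adjC.
- by rewrite eq_sym; case: (gL' u (negbT uS)) => _; apply.
- by apply: gP; rewrite ?inE ?uS ?vS.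
Qed.

End ListColouring.

(** * Deficits of badable sets *)

Section Deficit.
Variables (G : sgraph) (C : choiceType) (c0 : C).
Implicit Types (A B K X Q : {set G}) (D : nat).

Definition deficit D K := \sum_(v in K) (D - degin K v).

(** Only [z] is counted twice: with degrees [a] and [b] on the two sides it contributes [D - a - b]
    on the left and [(D - a) + (D - b)] on the right. *)
Lemma deficit_sep D K A B z :
  (forall v, v \in K -> degin K v <= D) -> sep K A B z ->
  deficit D K + D = deficit D A + deficit D B.
Proof.
move=> degD h; rewrite /deficit.
have zA := sep_zA h; have zB := sep_zB h.
have zK := subsetP (sep_subA h) _ zA.
rewrite (big_setD1 z zK) (big_setD1 z zA) (big_setD1 z zB) /=.
rewrite (big_setID A) /=.
have -> : (K :\ z) :&: A = A :\ z.
  by rewrite setIDAC (setIidPr (sep_subA h)).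
have -> : (K :\ z) :\: A = B :\ z.
  apply/setP => x; rewrite !inE; have [->|xz] /= := eqVneq x z; first by rewrite zA.
  case: (h) => -[-> _ _] _ _; rewrite inE.
  have [xA|//] := boolP (x \in A); apply/esym/negP => xB.
  by rewrite (sep_inAB h xA xB) eqxx in xz.
have -> : \sum_(i in A :\ z) (D - degin K i) = \sum_(i in A :\ z) (D - degin A i).
  apply: eq_bigr => i; rewrite !inE => /andP[iz iA].
  by rewrite (sep_degA h).
have -> : \sum_(i in B :\ z) (D - degin K i) = \sum_(i in B :\ z) (D - degin B i).
  apply: eq_bigr => i; rewrite !inE => /andP[iz iB].
  by rewrite (sep_degA (sepC h)).
by have := degD z zK; rewrite (sep_degz h); lia.
Qed.

Lemma sum_adj K v : \sum_(w in K) (adj w v : nat) = degin K v.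
Proof.
rewrite /degin -sum1_card big_mkcond [RHS]big_mkcond /=; apply: eq_bigr => w _.
by rewrite !inE (adjC w); case: (w \in K); case: (adj v w).
Qed.

Lemma deficit_U1 D K v :
  (forall w, w \in v |: K -> degin (v |: K) w <= D) -> v \notin K ->
  deficit D (v |: K) + 2 * degin K v = deficit D K + D.
Proof.
move=> degD vK; rewrite /deficit big_setU1 //=.
have := degD v (setU11 v K); rewrite (degin_U1 _ vK) adj_irr add0n => dv.
have -> : \sum_(i in K) (D - degin K i) =
          \sum_(i in K) (D - degin (v |: K) i) + degin K v.
  rewrite -sum_adj -big_split /=; apply: eq_bigr => w wK.
  have := degD w; rewrite in_setU1 wK orbT => /(_ isT).
  by rewrite (degin_U1 _ vK); lia.
lia.
Qed.

Lemma deficit_regular D K d :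
  (forall v, v \in K -> degin K v = d) -> deficit D K = #|K| * (D - d).
Proof.
by move=> h; rewrite /deficit (eq_bigr (fun=> D - d)) ?sum_nat_const // => v /h->.
Qed.

Lemma badable_deficit D K :
  3 <= D -> badable C K -> (forall v, v \in K -> degin K v <= D) ->
  (exists2 v, v \in K & degin K v < D) ->
  D <= deficit D K /\ (deficit D K = D -> #|K| = 1 \/ #|K| = D).
Proof.
move=> D3; have [n] := ubnP #|K|; elim: n K => // n IH K; rewrite ltnS => leKn.
move=> bK degD [v vK vD]; have cK := badable_conn bK.
have [ncK|[A [B [z h]]]] := nocut_or_sep cK.
  (* Here [K] is [d]-regular with [d < D] and [d < #|K|], so its deficit is at least
     [(d + 1) * (D - d)], which is at least [D] with equality only for [d = 0] and [d = D - 1]. *)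
  have [d dK] := nocut_degin c0 bK ncK.
  rewrite (deficit_regular D dK); rewrite (dK v vK) in vD.
  have := degin_lt_card vK; rewrite (dK v vK) => ltK.
  split; [nia | move=> e].
  have [d0|d0] : d = 0 \/ d = D.-1 by nia.
    by left; nia.
  by right; nia.
have [bA bB] := sep_badable c0 bK h.
(* Equality for [K] would force deficit [D] on both sides, so [z] would have degree [D.-1] in each
   of them; but [2 * (D - 1) > D]. *)
have side A' B' : sep K A' B' z -> badable C A' ->
    [/\ D <= deficit D A', deficit D A' = D -> degin A' z = D.-1 & 0 < degin A' z].
  move=> h' bA'; have cA' := badable_conn bA'.
  have zA := sep_zA h'; have zK := subsetP (sep_subA h') _ zA.
  have degA w : w \in A' -> degin A' w <= D.
    move=> wA; apply: leq_trans (degD w (subsetP (sep_subA h') _ wA)).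
    exact/degin_sub/(sep_subA h').
  have [|| le eqD] := IH A' _ bA' degA.
  - exact: leq_trans (sep_cardA h') leKn.
  - by exists z => //; apply: leq_trans (degin_ltA h') (degD z zK).
  have A1 : 1 < #|A'| by case: h' => _ [].
  split=> //; last exact: degin_gt0.
  move=> e; case: (eqD e) => cardA; first by rewrite cardA in A1.
  move: e; rewrite /deficit (big_setD1 z zA) /=.
  have : \sum_(i in A' :\ z) 1 <= \sum_(i in A' :\ z) (D - degin A' i).
    by apply: leq_sum => i; rewrite !inE => /andP[_ iA]; have := degin_lt_card iA; lia.
  rewrite sum1_card; have := degin_lt_card zA; have := cardsD1 z A'; rewrite zA.
  lia.
have [leA eA A0] := side A B h bA; have [leB eB B0] := side B A (sepC h) bB.
have zK := subsetP (sep_subA h) _ (sep_zA h).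
have := deficit_sep degD h; have := degD z zK; rewrite (sep_degz h).
by move=> dz e; split; [lia | move=> e'; lia].
Qed.

(* Deleting a non-cut vertex from [K] leaves deficit exactly [D], hence [K_1] or
   [K_D] by the equality case of [badable_deficit]. *)
Lemma badable_brooks D K :
  3 <= D -> badable C K -> (forall v, v \in K -> degin K v = D) -> #|K| = D.+1.
Proof.
move=> D3 bK degD; have cK := badable_conn bK.
have [x xK] := conn_neq0 cK.
have xnK : [set x] != K.
  apply: contraTneq (degin_lt_card xK) => KE.
  by rewrite (degD x xK) -KE cards1; lia.
have xK' : [set x] \subset K by rewrite sub1set.
have [v [vK _ cKv]] := noncut_exists (conn1 x) cK xK' xnK.
have bKv : badable C (K :\ v) by apply: badable_sub bK (subD1set _ _) cKv.
have KE : v |: (K :\ v) = K by rewrite setD1K.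
have vKv : v \notin K :\ v by rewrite !inE eqxx.
have degKv w : w \in K :\ v -> degin (K :\ v) w <= D.
  by rewrite !inE => /andP[_ wK]; rewrite -(degD w wK) degin_sub // subD1set.
have dv : degin (K :\ v) v = D.
  by rewrite -(degD v vK) (degin_D1 v vK) adj_irr.
have e : deficit D (K :\ v) = D.
  have := @deficit_U1 D (K :\ v) v _ vKv; rewrite KE dv (deficit_regular D degD).
  by rewrite subnn muln0 => h; have := h (fun w wK => eq_leq (degD w wK)); lia.
have [w] : exists w, w \in nb v :&: (K :\ v).
  by apply/set0Pn; rewrite -card_gt0 -/(degin _ _) dv; lia.
rewrite !inE => /andP[vw /andP[wv wK]].
have cardK : #|K| = #|K :\ v|.+1 by rewrite (cardsD1 v) vK.
have ltDK := degin_lt_card vK; rewrite (degD v vK) in ltDK.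
have [|_ /(_ e) cardKv] := badable_deficit D3 bKv degKv.
  exists w; first by rewrite !inE wv.
  by rewrite -(degD w wK) (degin_D1 w vK) (adjC w) vw.
by move: D3 cardK ltDK cardKv; clear; lia.
Qed.

End Deficit.

(** * Non-cut vertices across a separation, and end blocks *)

Section SepNoncut.
Variable G : sgraph.
Implicit Types (A B K : {set G}).

Lemma sep_noncutW K A B z v :
  sep K A B z -> v \in B -> v != z -> noncut B v -> noncut K v.
Proof.
move=> h vB vz ncB; have [[KE _ [cA cB]] [_ B1] _] := h.
have zBv : z \in B :\ v by rewrite !inE eq_sym vz (sep_zB h).
apply/orP; right; suff -> : K :\ v = A :|: (B :\ v).
  exact: connU cA (noncut_conn cB B1 ncB) (sep_zA h) zBv.
rewrite KE setDUl; congr (_ :|: _); apply/setDidPl.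
rewrite disjoint_sym disjoints1; apply: contra vz => vA.
by apply/eqP; apply: (sep_inAB h vA vB).
Qed.

Lemma sep_cut K A B z : sep K A B z -> ~~ noncut K z.
Proof.
move=> h; have [[KE _ _] [A1 B1] hAB] := h.
have other X Y : sep K X Y z -> 1 < #|X| -> exists2 x, x \in X & x != z.
  move=> h' X1; have : 0 < #|X :\ z| by have := cardsD1 z X; rewrite (sep_zA h'); lia.
  by rewrite card_gt0 => /set0Pn[x]; rewrite !inE => /andP[xz xX]; exists x.
have [a aA az] := other _ _ h A1; have [b bB bz] := other _ _ (sepC h) B1.
have aK : a \in K :\ z by rewrite !inE az (subsetP (sep_subA h)).
have bK : b \in K :\ z by rewrite !inE bz (subsetP (sep_subB h)).
apply/negP => /orP[/eqP e|cK]; first by rewrite e inE in aK.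
have clA : closed_in (A :\ z) (K :\ z).
  apply/closed_inP; split; first exact/setSD/(sep_subA h).
  move=> x y xA; rewrite !inE => /andP[yz yK] xy; rewrite yz /=.
  move: yK; rewrite KE inE => /orP[//|yB].
  by have := hAB x y xA; rewrite !inE yz yB xy => /(_ isT).
have aA' : a \in A :\ z by rewrite !inE az.
move: bK; rewrite -(conn_closed cK clA aA') !inE => /andP[_ bA].
by rewrite (sep_inAB h bA bB) eqxx in bz.
Qed.

(** A part of [A :\ v] that does not reach [z] has no edge into [B], so it would be closed in the
    connected set [K :\ v], which contains [z]. *)
Lemma sep_noncut K A B z v :
  sep K A B z -> v \in A -> v != z -> noncut K v -> noncut A v.
Proof.
move=> h vA vz ncK; have [[KE _ [cA cB]] [A1 B1] hAB] := h.
have cK : conn K by rewrite KE; apply: connU cA cB (sep_zA h) (sep_zB h).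
have K1 : 1 < #|K| by have := sep_cardA h; lia.
have cKv := noncut_conn cK K1 ncK.
apply/orP; right; apply: (@conn_intro _ _ z).
  by rewrite !inE eq_sym vz (sep_zA h).
move=> X clX zX; rewrite -setD_eq0; apply: contraT => /set0Pn[y yX].
have clY : closed_in ((A :\ v) :\: X) (K :\ v).
  have /closed_inP[sub cl] := closed_in_compl clX.
  apply/closed_inP; split; first by rewrite (subset_trans sub) // setSD // (sep_subA h).
  move=> a b aY /setD1P[bv bK] ab.
  apply: (cl a) => //; rewrite !inE bv /=.
  move: bK; rewrite KE inE => /orP[//|bB]; have [->|bz] := eqVneq b z.
    exact: sep_zA h.
  have := hAB a b; rewrite !inE bz bB ab => /(_ _ isT)/negP.
  move: aY; rewrite !inE => /and3P[aX av ->]; rewrite andbT.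
  by have [az|_ /(_ isT)//] := eqVneq a z; rewrite az zX in aX.
have zK : z \in K :\ v by rewrite !inE eq_sym vz (subsetP (sep_subA h)) ?(sep_zA h).
by move: zK; rewrite -(conn_closed cKv clY yX) !inE zX.
Qed.

Lemma sep_refine K A B z A1 A2 z' :
  sep K A B z -> sep A A1 A2 z' -> z \in A2 ->
  sep K A1 (A2 :|: B) z' /\ A1 :\ z' \subset A :\ z.
Proof.
move=> h h1 zA2; have [[KE IE [cA cB]] [cardA cardB] hAB] := h.
have [[AE IE1 [cA1 cA2]] [card1 card2] hA] := h1.
have subA := sep_subA h1.
have sub : A1 :\ z' \subset A :\ z.
  apply/subsetP => x; rewrite !inE => /andP[xz' xA1].
  rewrite (subsetP subA) // andbT; apply: contra xz' => /eqP xz.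
  by apply/eqP; apply: (sep_inAB h1 xA1); rewrite xz.
split=> //; split.
- split; first by rewrite setUA -AE.
    apply/setP => x; rewrite -IE1 !inE; case xA1: (x \in A1) => //=.
    case xA2: (x \in A2) => //=; apply/negP => xB.
    have xz := sep_inAB h (subsetP subA _ xA1) xB.
    by rewrite xz zA2 in xA2.
  by split=> //; apply: connU cA2 cB zA2 (sep_zB h).
- by split=> //; apply: leq_trans card2 (subset_leq_card (subsetUl _ _)).
move=> a b aA1; rewrite !inE => /andP[bz' bAB].
have [bA2|bA2] := boolP (b \in A2); first by apply: hA => //; rewrite !inE bz'.
rewrite (negbTE bA2) /= in bAB; apply: hAB; first exact: (subsetP sub).
by rewrite !inE bAB andbT; apply: contraNneq bA2 => ->.
Qed.

(** If [A] has a cut vertex, one side is kept and the other, containing [z], joins [B]. The last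
    conclusion makes end blocks found on opposite sides of a separation disjoint apart from their
    attachment vertices. *)
Lemma end_block K A B z : sep K A B z ->
  exists A' B' z', [/\ sep K A' B' z', nocut A' & A' :\ z' \subset A :\ z].
Proof.
have [n] := ubnP #|A|; elim: n A B z => // n IH A B z; rewrite ltnS => leAn h.
have [[_ _ [cA _]] _ _] := h.
have [ncA|[A1 [A2 [z' h1]]]] := nocut_or_sep cA; first by exists A, B, z.
suff [X [Y [hX zY]]] : exists X Y, sep A X Y z' /\ z \in Y.
  have [h2 sub] := sep_refine h hX zY.
  have [|A' [B' [z2 [hK nc sub']]]] := IH _ _ _ _ h2.
    exact: leq_trans (sep_cardA hX) leAn.
  by exists A', B', z2; split=> //; apply: subset_trans sub.
have := sep_zA h; case: (h1) => -[{1}-> _ _] _ _; rewrite inE => /orP[zA1|zA2].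
  by exists A2, A1; split=> //; apply: sepC.
by exists A1, A2.
Qed.

End SepNoncut.

(** * Graphs of maximum degree [D] other than [K_(D+1)] *)

Section Main.
Variables (G : sgraph) (C : choiceType) (c0 : C) (D : nat).
Hypothesis D3 : 3 <= D.
Hypothesis degG : forall v : G, #|nb v| <= D.
Hypothesis connG : conn [set: G].
Hypothesis notK : ~ (#|G| = D.+1 /\ forall v : G, #|nb v| = D).
Implicit Types (A B K P U X Y Q : {set G}) (u v w x y z : G).

Local Notation badable := (badable C).
Local Notation deficitD := (deficit D).

Lemma degin_le K v : degin K v <= D.
Proof. by apply: leq_trans (degG v); apply: subset_leq_card (subsetIl _ _). Qed.

Lemma no_full_set K :
  #|K| = D.+1 -> (forall v, v \in K -> degin K v = D) -> False.
Proof.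
move=> cardK degK.
have nbK v : v \in K -> nb v \subset K.
  move=> vK; apply/setIidPl/eqP; rewrite eqEcard subsetIl /=.
  by rewrite -/(degin K v) degK.
have [x xK] : exists x, x \in K by apply/set0Pn; rewrite -card_gt0 cardK.
have KT : K = [set: G].
  apply: (conn_closed connG _ xK); apply/closed_inP; split; first exact: subsetT.
  by move=> a b aK _ ab; apply: (subsetP (nbK a aK)); rewrite inE.
apply: notK; split; first by rewrite -cardK KT cardsT.
move=> v; have vK : v \in K by rewrite KT inE.
by rewrite -(degK v vK) /degin KT setIT.
Qed.

Lemma badable_lt K : badable K -> exists2 v, v \in K & degin K v < D.
Proof.
move=> bK; have [/exists_inP//|] := boolP [exists v in K, degin K v < D].
move/exists_inPn => h.
have degK v : v \in K -> degin K v = D.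
  by move=> /h; rewrite -leqNgt => le; apply/eqP; rewrite eqn_leq degin_le.
by case: (no_full_set (badable_brooks c0 D3 bK degK) degK).
Qed.

Lemma deficit_ge K : badable K -> D <= deficitD K.
Proof.
by move=> bK; case: (badable_deficit c0 D3 bK (fun v _ => degin_le K v) (badable_lt bK)).
Qed.

Lemma deficit_eq K : badable K -> deficitD K = D -> #|K| = 1 \/ #|K| = D.
Proof.
by move=> bK; case: (badable_deficit c0 D3 bK (fun v _ => degin_le K v) (badable_lt bK)).
Qed.

Lemma deficit_sepD K A B z : sep K A B z -> deficitD K + D = deficitD A + deficitD B.
Proof. by move=> h; apply: deficit_sep h => v _; apply: degin_le. Qed.

Lemma deficit_add1 K v : v \notin K ->
  deficitD (v |: K) + 2 * degin K v = deficitD K + D.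
Proof. by move=> vK; apply: deficit_U1 => // w _; apply: degin_le. Qed.

(** Equality is possible only at [D], where [K] is complete on [D] vertices, all adjacent to [v]: a
    forbidden [K_(D+1)]. Strictness later yields an edge from each blocking set to [P]. *)
Lemma degin_lt_deficit K v : badable K -> v \notin K -> degin K v < deficitD K.
Proof.
move=> bK vK; have geD := deficit_ge bK; have leD := degin_le K v.
rewrite ltn_neqAle (leq_trans leD geD) andbT; apply/negP => /eqP e.
have eD : deficitD K = D by apply/eqP; rewrite eqn_leq geD -e leD.
have dv : degin K v = D by rewrite e.
have lecard : degin K v <= #|K| by apply: subset_leq_card (subsetIr _ _).
have cardK : #|K| = D by case: (deficit_eq bK eD) => // c1; rewrite c1 dv in lecard; lia.
have sub : nb v :&: K = K.
  by apply/eqP; rewrite eqEcard subsetIr /= cardK -dv.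
have degK w : w \in K -> degin K w = D.-1.
  move=> wK; apply/eqP; rewrite eqn_leq; have := degin_lt_card wK; rewrite cardK.
  move=> lt; apply/andP; split; first lia.
  have hle : \sum_(i in K :\ w) 1 <= \sum_(i in K :\ w) (D - degin K i).
    apply: leq_sum => i; rewrite !inE => /andP[_ /degin_lt_card]; rewrite cardK; lia.
  move: eD hle; rewrite /deficit (big_setD1 w wK) /= sum1_card.
  by have := cardsD1 w K; rewrite wK cardK; clear -D3 lt; lia.
apply: (@no_full_set (v |: K)); first by rewrite cardsU1 vK cardK.
move=> w; rewrite in_setU1 => /orP[/eqP->|wK].
  by rewrite degin_U1 // adj_irr.
have vw : adj w v by move: wK; rewrite -{1}sub !inE adjC => /andP[].
by rewrite degin_U1 // vw degK //; lia.
Qed.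

Lemma block_regular Q : badable Q -> nocut Q ->
  exists d, [/\ d < D, d < #|Q|, forall v, v \in Q -> degin Q v = d
             & deficitD Q = #|Q| * (D - d)].
Proof.
move=> bQ ncQ; have [d dQ] := nocut_degin c0 bQ ncQ.
have [v vQ vD] := badable_lt bQ.
exists d; split=> //; last exact: deficit_regular.
  by rewrite -(dQ v vQ).
by rewrite -(dQ v vQ) degin_lt_card.
Qed.

(** The descent into the side containing [y] keeps the degree of [y], and it does not raise the
    deficit because the discarded side has deficit at least [D]. *)
Lemma block_exists K y : badable K -> y \in K -> noncut K y ->
  exists Q, [/\ Q \subset K /\ y \in Q, badable Q, nocut Q,
    degin Q y = degin K y & deficitD Q <= deficitD K].
Proof.
have [n] := ubnP #|K|; elim: n K => // n IH K; rewrite ltnS => leKn bK yK ncy.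
have cK := badable_conn bK.
have [ncK|[A [B [z h]]]] := nocut_or_sep cK; first by exists K.
have yz : y != z by apply: contraTneq ncy => ->; apply: sep_cut h.
suff [X [Y [hX yX]]] : exists X Y, sep K X Y z /\ y \in X.
  have [bX bY] := sep_badable c0 bK hX.
  have [|Q [[QX yQ] bQ ncQ dQ le]] := IH X _ bX yX (sep_noncut hX yX yz ncy).
    exact: leq_trans (sep_cardA hX) leKn.
  exists Q; split=> //; first by split=> //; apply: subset_trans (sep_subA hX).
    by rewrite dQ (sep_degA hX).
  apply: leq_trans le _; have := deficit_sepD hX; have := deficit_ge bY; clear; lia.
move: yK; case: (h) => -[{1}-> _ _] _ _; rewrite inE => /orP[yA|yB].
  by exists A, B.
by exists B, A; split=> //; apply: sepC.
Qed.

Lemma noncut_degin K y : badable K -> y \in K -> noncut K y -> degin K y < D.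
Proof.
move=> bK yK ncy; have [Q [[_ yQ] bQ ncQ <- _]] := block_exists bK yK ncy.
by have [d [dD _ -> //]] := block_regular bQ ncQ.
Qed.

(** All lists are the same pair of colours, and a 2-regular graph on four vertices is bipartite: the
    neighbours of [y] against [y] and the remaining vertex [y']. *)
Lemma bad_nocut_not_C4 Q :
  badable Q -> nocut Q -> #|Q| = 4 -> (forall v, v \in Q -> degin Q v = 2) -> False.
Proof.
move=> bQ ncQ card4 deg2; case: (bQ) => L bL.
have [y yQ] : exists y, y \in Q by apply/set0Pn; rewrite -card_gt0 card4.
have sizeL : #|` L y| = 2 by rewrite (bad_tight c0 bL yQ) deg2.
have [a aL] : exists a, a \in L y by apply/fset0Pn; rewrite -cardfs_gt0 sizeL.
have [b] : exists b, b \in (L y `\ a)%fset.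
  by apply/fset0Pn; rewrite -cardfs_gt0; have := cardfsD1 a (L y); rewrite aL sizeL; lia.
rewrite !inE => /andP[ba bL'].
set N := nb y :&: Q; have cardN : #|N| = 2 by rewrite -(deg2 y yQ).
have yN : y \notin N by rewrite !inE adj_irr.
have cardR : #|Q :\: (y |: N)| = 1.
  rewrite cardsD (setIidPr _) ?cardsU1 ?yN ?card4 ?cardN //.
  by rewrite subUset sub1set yQ subsetIr.
have /cards1P[y' RE] : #|Q :\: (y |: N)| == 1 by rewrite cardR.
have outR w : w \in Q -> w \notin N -> w = y \/ w = y'.
  move=> wQ wN; have [->|wy] := eqVneq w y; [by left | right].
  by apply/set1P; rewrite -RE in_setD in_setU1 negb_or wy wN.
have : y' \in Q :\: (y |: N) by rewrite RE set11.
rewrite in_setD in_setU1 negb_or => /andP[/andP[y'y y'N] y'Q].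
have yy' : ~~ adj y y' by move: y'N; rewrite !inE y'Q andbT.
have nby' : nb y' :&: Q = N.
  apply/eqP; rewrite eqEcard -/(degin Q y') deg2 // cardN leqnn andbT.
  apply/subsetP => w /setIP[]; rewrite inE => y'w wQ.
  apply: contraT => wN; case: (outR w wQ wN) => e; last by rewrite e adj_irr in y'w.
  by rewrite e adjC (negbTE yy') in y'w.
have LE w : w \in Q -> L w = L y by move=> wQ; apply: (nocut_regular c0 bL).
have nonadj u w : u \in Q -> w \in Q -> adj u w -> (u \in N) != (w \in N).
  move=> uQ wQ uw; have [uN|uN] := boolP (u \in N).
    apply/negP => /eqP/esym wN.
    have : [set y; y'; w] \subset nb u :&: Q.
      have : u \in nb y' :&: Q by rewrite nby'.
      move: (uN); rewrite !inE => /andP[yu _] /andP[y'u _].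
      apply/subsetP => x; rewrite !inE => /orP[/orP[]|] /eqP->.
      - by rewrite adjC yu.
      - by rewrite adjC y'u.
      - by rewrite uw wQ.
    move/subset_leq_card; rewrite -/(degin Q u) deg2 // setUC cardsU1 cards2 eq_sym y'y.
    suff -> : w \notin [set y; y'] by [].
    by apply: contraL wN => /set2P[]->.
  apply/negP => /eqP/esym wN.
  case: (outR u uQ uN) => eu; case: (outR w wQ (negbT wN)) => ew;
    move: uw; rewrite eu ew.
  - by rewrite adj_irr.
  - by rewrite (negbTE yy').
  - by rewrite adjC (negbTE yy').
  - by rewrite adj_irr.
case: (bL) => _ _; apply; exists (fun w => if w \in N then b else a).
split=> [w wQ|u w uQ wQ uw]; first by rewrite LE //; case: ifP.
have := nonadj u w uQ wQ uw; case: (u \in N); case: (w \in N) => // _.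
by rewrite eq_sym.
Qed.

(** For [4 <= D], [badable_brooks] applies with [D.-1] in place of [D]. For [D = 3] the set is a
    cycle whose deficit is its length, at most 4, and excluding the 4-cycle leaves a triangle. *)
Lemma block_card Q y : badable Q -> nocut Q -> y \in Q -> degin Q y = D.-1 ->
  4 <= D \/ deficitD Q <= D.+1 -> #|Q| = D.
Proof.
move=> bQ ncQ yQ dy D4; have [d [dD ltd dQ defQ]] := block_regular bQ ncQ.
have ed : d = D.-1 by rewrite -dy dQ.
rewrite {}ed in dQ defQ ltd.
have [D4'|D4'] := leqP 4 D.
  have := badable_brooks c0 _ bQ dQ; clear -D4'; lia.
have De : D = 3 by apply/eqP; rewrite eqn_leq D3 -ltnS D4'.
case: D4 => [|le]; first by rewrite De.
have {}defQ : deficitD Q = #|Q| by rewrite defQ De /=; clear; lia.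
rewrite defQ in le.
have [e|ne] := eqVneq #|Q| 4; last by rewrite De in le ltd *; clear -le ltd ne; lia.
by case: (bad_nocut_not_C4 bQ ncQ e) => v /dQ->; rewrite De.
Qed.

Lemma nb_clique K y u v : badable K -> y \in K -> noncut K y -> degin K y = D.-1 ->
  4 <= D \/ deficitD K <= D.+1 ->
  u \in y |: (nb y :&: K) -> v \in y |: (nb y :&: K) -> u != v -> adj u v.
Proof.
move=> bK yK ncy dy D4.
have [Q [[QK yQ] bQ ncQ dQ le]] := block_exists bK yK ncy.
have cardQ : #|Q| = D.
  apply: (block_card bQ ncQ yQ); first by rewrite dQ.
  by case: D4; [left | right; apply: leq_trans le _].
have nbQ : nb y :&: K = nb y :&: Q.
  apply/esym/eqP; rewrite eqEcard setIS //=.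
  by rewrite -/(degin Q y) -/(degin K y) dQ.
have [d [_ _ degQ _]] := block_regular bQ ncQ.
have dE : d = #|Q|.-1 by rewrite -(degQ y yQ) dQ dy cardQ.
have sub : y |: (nb y :&: Q) \subset Q by rewrite subUset sub1set yQ subsetIr.
rewrite nbQ => /(subsetP sub) uQ /(subsetP sub) vQ.
by apply: (full_adj uQ vQ); rewrite degQ.
Qed.

Definition lowset K := [set v in K | ~~ noncut K v || (degin K v == 1)].

(* Split off an end block [A] at [z]. It pays for [z] by its deficit above [D],
   unless it is [(D-1)]-regular; then [z] has degree 1 in the rest [B], where it
   is already counted. *)
Lemma low_bound K : badable K -> #|lowset K| + 2 * D <= 2 * deficitD K.
Proof.
have [n] := ubnP #|K|; elim: n K => // n IH K; rewrite ltnS => leKn bK.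
have cK := badable_conn bK.
have [ncK|[A0 [B0 [z0 h0]]]] := nocut_or_sep cK.
  have [d [dD ltd dQ defQ]] := block_regular bK ncK.
  have [d1|d1] := eqVneq d 1.
    have le : #|lowset K| <= #|K|.
      by apply/subset_leq_card/subsetP => v; rewrite inE => /andP[].
    by rewrite defQ d1; rewrite d1 in ltd; clear -le ltd D3; nia.
  suff -> : lowset K = set0 by rewrite cards0 leq_mul2l (deficit_ge).
  apply/setP => v; rewrite !inE; apply/negP => /andP[vK].
  by rewrite (forall_inP ncK _ vK) dQ //= (negbTE d1).
have [A [B [z [h ncA _]]]] := end_block h0.
have [bA bB] := sep_badable c0 bK h.
have [[KE _ [cA cB]] [A1 B1] _] := h.
have [d [dD ltd dA defA]] := block_regular bA ncA.
have IHB : #|lowset B| + 2 * D <= 2 * deficitD B.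
  by apply: IH => //; apply: leq_trans (sep_cardA (sepC h)) leKn.
have eK := deficit_sepD h.
have gA := deficit_ge bA.
have d0 : 0 < d by rewrite -(dA z (sep_zA h)) degin_gt0 // (sep_zA h).
have sub v : v \in lowset K -> v \in lowset B \/ v = z \/ v \in A /\ d = 1.
  rewrite inE KE inE -KE => /andP[vAB low].
  have [->|vz] := eqVneq v z; first by right; left.
  have [vA|vA] := boolP (v \in A).
    right; right; split=> //.
    have := sep_noncutW (sepC h) vA vz (forall_inP ncA _ vA) => nc.
    by move: low; rewrite nc /= (sep_degA h vA vz) dA // => /eqP.
  rewrite (negbTE vA) /= in vAB; left; rewrite inE vAB /=.
  case/orP: low => [ncv|]; last by rewrite (sep_degA (sepC h)) // => ->; rewrite orbT.
  by rewrite (contra (sep_noncutW h vAB vz)).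
have [d1|d1] := eqVneq d 1.
  have : lowset K \subset lowset B :|: A.
    apply/subsetP => v /sub[vB|[->|[vA _]]]; rewrite inE ?vB ?vA ?orbT //.
    by rewrite (sep_zA h) orbT.
  move/subset_leq_card; have := cardsU (lowset B) A; move: eK IHB.
  rewrite defA d1; clear -D3 A1; nia.
have [dD1|dD1] := eqVneq d D.-1.
  have : lowset K \subset lowset B.
    apply/subsetP => v /sub[//|[->|[_ e]]]; last by rewrite e eqxx in d1.
    have zB := sep_zB h; rewrite inE zB; apply/orP; right.
    have := degin_le K z; rewrite (sep_degz h) (dA z (sep_zA h)) dD1.
    have := degin_gt0 cB B1 zB; clear -D3; lia.
  by move/subset_leq_card; move: eK IHB gA; clear; lia.
have : lowset K \subset z |: lowset B.
  apply/subsetP => v /sub[vB|[->|[_ e]]]; rewrite !inE ?eqxx //.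
    by move: vB; rewrite !inE => ->; rewrite orbT.
  by rewrite e eqxx in d1.
move/subset_leq_card; rewrite cardsU1.
have : D < deficitD A by rewrite defA; clear -ltd dD dD1 d1 d0; nia.
by move: eK IHB; case: (z \in lowset B); clear; lia.
Qed.

Lemma no_full_star v :
  #|nb v| = D -> {in v |: nb v &, forall a b, a != b -> adj a b} -> False.
Proof.
move=> dv cl; have vN : v \notin nb v by rewrite inE adj_irr.
apply: (no_full_set (K := v |: nb v)); first by rewrite cardsU1 vN dv.
move=> a aS; have -> : degin (v |: nb v) a = #|(v |: nb v) :\ a|.
  congr #|pred_of_set _|; apply/setP => b; rewrite !inE.
  have [->|ba] /= := eqVneq b a; first by rewrite adj_irr.
  case bS: ((b == v) || adj v b); last by rewrite andbF.
  by rewrite cl // ?in_setU1 ?inE // eq_sym.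
by have := cardsD1 a (v |: nb v); rewrite aS cardsU1 vN dv; clear; lia.
Qed.

(** * Unweighted requests *)

Definition edges_to P X := \sum_(v in X) degin P v.

(* [K] is a component of [G - P - u] that cannot be coloured once [P] and [u] are. *)
Definition blocked P u K :=
  [/\ badable K, [/\ u \notin K, u \notin P & degin P u = 0],
      closed_in K (~: P :\ u), forall v, v \in K -> #|nb v| = D & 0 < degin K u].

Section Blocked.
Variables (P K : {set G}) (v : G).
Hypothesis blK : blocked P v K.

Lemma blocked_nb w x : w \in K -> adj w x -> x \notin P -> x != v -> x \in K.
Proof.
case: blK => _ _ /closed_inP[_ cl] _ _ wK wx xP xv.
by apply: (cl w) => //; rewrite !inE xv.
Qed.

Lemma blocked_out w : w \in K -> w \notin P /\ w != v.
Proof.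
case: blK => _ _ /closed_inP[/subsetP sub _] _ _ /sub.
by rewrite !inE => /andP[].
Qed.

Lemma blocked_deg w : w \in K -> degin K w + degin P w + adj w v = D.
Proof.
move=> wK; have [_ [vK vP _] _ degK _] := blK.
rewrite -(degK w wK) -(cardsID K (nb w)) -addnA; congr (_ + _).
rewrite addnC -(degin_U1 w vP); congr #|pred_of_set _|.
apply/setP => x; rewrite !inE; case wx: (adj w x); rewrite ?andbF //= andbT.
have [xK|xK] := boolP (x \in K).
  by have [/negbTE-> /negbTE->] := blocked_out xK.
have [->|xv] /= := eqVneq x v; first by [].
by apply: contraR xK => xP; apply: blocked_nb wK wx xP xv.
Qed.

Lemma blocked_deficit : deficitD K = edges_to P K + degin K v.
Proof.
rewrite /edges_to -sum_adj -big_split /=; apply: eq_bigr => w /blocked_deg; lia.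
Qed.

Lemma blocked_edges : 0 < edges_to P K.
Proof.
have [bK [vK _ _] _ _ _] := blK.
have := degin_lt_deficit bK vK.
by rewrite blocked_deficit; lia.
Qed.

Lemma blocked_conn : conn (v |: K).
Proof.
have [bK _ _ _] := blK; rewrite card_gt0 => /set0Pn[x]; rewrite !inE => /andP[vx xK].
by apply: connU1 (badable_conn bK) xK _; rewrite adjC.
Qed.

(** If [K'] met [K], the connected set [v |: K], which avoids [P] and [u], would lie inside the
    component [K'], but it is larger. *)
Lemma blocked_disjoint u K' :
  blocked P u K' -> #|K'| <= #|K| -> u \notin v |: K -> [disjoint K' & K].
Proof.
move=> blK' le; rewrite in_setU1 negb_or => /andP[uv uK].
have [_ [vK vP _] _ _ _] := blK; have [_ _ clK' _ _] := blK'.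
rewrite disjoint_subset; apply/subsetP => x xK'; rewrite inE; apply/negP => xK.
have sub : v |: K \subset ~: P :\ u.
  apply/subsetP => y; rewrite !inE => /orP[/eqP->|yK]; first by rewrite eq_sym uv vP.
  have [-> _] := blocked_out yK; rewrite andbT.
  by apply: contraNneq uK => <-.
have := conn_sub_closed blocked_conn sub clK' (x := x).
rewrite in_setU1 xK orbT => /(_ isT xK')/subset_leq_card.
by rewrite cardsU1 vK; move: le; clear; lia.
Qed.

End Blocked.

Section LargestBlocked.
Variables (P U : {set G}) (Kf : G -> {set G}) (v : G).
Hypothesis blU : forall u, u \in U -> blocked P u (Kf u).
Hypothesis vU : v \in U.
Hypothesis vmax : forall u, u \in U -> #|Kf u| <= #|Kf v|.

Local Notation K := (Kf v).
Local Notation N := [set u in U :&: K | u \notin lowset K].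

(** As [u] has no neighbour in [P], its [D] neighbours lie in [v |: K]; being a non-cut vertex of
    [K], it has fewer than [D] of them in [K]. *)
Lemma nonlow_facts u : u \in N ->
  [/\ u \in U, u \in K, noncut K u, adj u v & degin K u = D.-1].
Proof.
have blK := blU vU; have [bK _ _ _ _] := blK.
rewrite !inE => /andP[/andP[uU uK]]; rewrite uK negb_or negbK => /andP[ncu _].
have [_ [_ _ Pu] _ _ _] := blU uU.
have := noncut_degin bK uK ncu.
have := blocked_deg blK uK; rewrite Pu; case: (adj u v) => /= e lt; split=> //; clear -e lt; lia.
Qed.

(* If [v] has two neighbours in [K], maximality of [K] makes the set blocking [u]
   equal to [K] with [u] replaced by [v]. *)
Section Swap.
Variable u : G.
Hypotheses (uN : u \in N) (d2 : 1 < degin K v).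

Lemma swap_conn : conn (K :\ u).
Proof.
have [_ uK ncu _ _] := nonlow_facts uN; have [bK _ _ _ _] := blU vU.
apply: noncut_conn (badable_conn bK) _ ncu.
by apply: leq_trans d2 _; apply: subset_leq_card (subsetIr _ _).
Qed.

(** The right-hand side is connected, avoids [P] and [u], and meets the component [Kf u] in a
    neighbour of [u], so it lies inside; its size [#|K|] is the maximum. *)
Lemma swap_eq : Kf u = v |: (K :\ u).
Proof.
have [uU uK ncu uv dK] := nonlow_facts uN.
have blK := blU vU; have [bK [vK vP Pv] clK degK _] := blK.
have blu := blU uU; have [bu [uKu uP Pu] clu degu du] := blu.
have [x] : exists x, x \in (nb v :&: K) :\ u.
  by apply/set0Pn; rewrite -card_gt0; have := cardsD1 u (nb v :&: K);
    move: d2; rewrite /degin; case: (u \in _); clear; lia.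
rewrite !inE => /and3P[xu vx xK].
have xKu : x \in K :\ u by rewrite !inE xu.
have cX : conn (v |: (K :\ u)) by apply: connU1 swap_conn xKu _; rewrite adjC.
have sub : v |: (K :\ u) \subset ~: P :\ u.
  apply/subsetP => y; rewrite !inE => /orP[/eqP->|/andP[yu yK]].
    by rewrite vP andbT; apply: contraTneq uv => <-; rewrite adj_irr.
  by have [-> _] := blocked_out blK yK; rewrite yu.
have [w] : exists w, w \in nb u :&: Kf u by apply/set0Pn; rewrite -card_gt0.
rewrite !inE => /andP[uw wKu]; have [wP wu] := blocked_out blu wKu.
have wX : w \in v |: (K :\ u).
  rewrite !inE wu /=; have [//|wv] /= := eqVneq w v.
  exact: (blocked_nb blK uK uw wP wv).
apply/esym/eqP; rewrite eqEcard (conn_sub_closed cX sub clu wX wKu) /=.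
apply: leq_trans (vmax uU) _; have vKu : v \notin K :\ u by rewrite !inE (negbTE vK) andbF.
by rewrite cardsU1 vKu (cardsD1 u) uK.
Qed.

Lemma swap_nb : [/\ #|nb v| = D, nb v \subset K & degin K v = D].
Proof.
have [uU uK ncu uv dK] := nonlow_facts uN.
have blK := blU vU; have [bK [vK vP Pv] clK degK _] := blK.
have blu := blU uU; have [bu _ _ degu _] := blu.
have vKu : v \in Kf u by rewrite swap_eq setU11.
have sub : nb v \subset K.
  apply/subsetP => x; rewrite inE => vx; have [->//|xu] := eqVneq x u.
  have xP : x \notin P.
    apply/negP => xP; have : 0 < degin P v.
      by rewrite card_gt0; apply/set0Pn; exists x; rewrite !inE vx.
    by rewrite Pv.
  have := blocked_nb blu vKu vx xP xu; rewrite swap_eq !inE.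
  by case: eqVneq vx => [->|_ _ /andP[]//]; rewrite adj_irr.
by split; rewrite // ?/degin ?(setIidPl sub) degu.
Qed.

Lemma swap_clique : deficitD K <= D.+1 \/ 4 <= D ->
  {in v |: nb v &, forall a b, a != u -> b != u -> a != b -> adj a b}.
Proof.
move=> small; have [uU uK ncu uv dK] := nonlow_facts uN.
have [bu [uKu _ _] _ _ _] := blU uU; have [dv sub dKv] := swap_nb.
have [_ [vK _ _] _ _ _] := blU vU.
have vKu : v \notin K :\ u by rewrite !inE (negbTE vK) andbF.
have eqK : u |: (K :\ u) = K by rewrite setD1K.
have uD : u \notin K :\ u by rewrite !inE eqxx.
have du : degin (K :\ u) u = D.-1 by rewrite -dK (degin_D1 u uK) adj_irr.
have dv' : degin (K :\ u) v = D.-1.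
  by have := degin_D1 v uK; rewrite adjC uv dKv; clear; lia.
(* Both [u] and [v] have degree [D.-1] into [K :\ u], so exchanging them keeps the deficit. *)
have eqdef : deficitD (Kf u) = deficitD K.
  have := deficit_add1 vKu; have := deficit_add1 uD.
  by rewrite eqK -swap_eq du dv'; clear; lia.
have vKf : v \in Kf u by rewrite swap_eq setU11.
have ncv : noncut (Kf u) v.
  by apply/orP; right; rewrite swap_eq setU1K // swap_conn.
have dKf : degin (Kf u) v = D.-1 by rewrite swap_eq degin_U1 // adj_irr dv'.
have inS a : a \in v |: nb v -> a != u -> a \in v |: (nb v :&: Kf u).
  rewrite swap_eq !inE => /orP[->//|va] au; rewrite va au /=.
  by rewrite (subsetP sub) ?orbT // inE.
move=> a b aS bS au bu' ab.
apply: (nb_clique bu vKf ncv dKf) ab; rewrite ?inS //.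
by rewrite eqdef; case: small; [right|left].
Qed.

End Swap.

(* By [nb_clique] in [K] and in the swapped sets, all pairs in [N[v]] except
   possibly [y y'] are adjacent; counting the neighbours of a further [z] in [N(v)]
   forces that edge too, so [G] would be complete. *)
Lemma largest_no_pair y y' : deficitD K <= D.+1 \/ 4 <= D -> 1 < degin K v ->
  y \in N -> y' \in N -> y != y' -> False.
Proof.
move=> small d2 yN y'N yy'.
have [_ yK ncy yv dy] := nonlow_facts yN; have [_ y'K _ y'v _] := nonlow_facts y'N.
have [bK [vK _ _] _ _ _] := blU vU.
have [dv sub dKv] := swap_nb yN d2.
have cl := swap_clique yN d2 small; have cl' := swap_clique y'N d2 small.
apply: (no_full_star dv).
suff ady : adj y y'.
  move=> a b aS bS ab; have [ay|ay] := eqVneq a y; last first.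
    have [by'|by'] := eqVneq b y; last exact: cl.
    have [->|ay'] := eqVneq a y'; first by rewrite by' adjC.
    by apply: cl' => //; rewrite by'.
  have [->|by'] := eqVneq b y'; first by rewrite ay.
  by apply: cl' => //; rewrite ay.
have yv' : y \in nb v by rewrite inE adjC.
have y'v' : y' \in nb v by rewrite inE adjC.
have [z] : exists z, z \in nb v :\ y :\ y'.
  apply/set0Pn; rewrite -card_gt0; have := cardsD1 y (nb v); have := cardsD1 y' (nb v :\ y).
  by rewrite yv' dv; case: (y' \in _); clear -D3; lia.
rewrite !in_setD1 => /and3P[zy' zy zv].
have inS a : a \in nb v -> a \in v |: nb v by move=> h; rewrite in_setU1 h orbT.
have zS := inS z zv; have vN : v \notin nb v by rewrite inE adj_irr.
have nbz : (v |: nb v) :\ z = nb z.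
  apply/eqP; rewrite eqEcard; apply/andP; split; last first.
    apply: leq_trans (degG z) _; have := cardsD1 z (v |: nb v).
    by rewrite zS cardsU1 vN dv; clear; lia.
  apply/subsetP => a /setD1P[az aS]; rewrite inE.
  have [ay|ay] := eqVneq a y; last by apply: cl => //; rewrite eq_sym.
  by apply: cl' => //; rewrite ?ay // eq_sym -?ay.
have zK := subsetP sub _ zv.
have yz : adj y z.
  have : y \in nb z by rewrite -nbz !inE eq_sym zy adjC yv orbT.
  by rewrite inE adjC.
(* By [nb_clique] each neighbour of [y] in [K] is [z] or adjacent to [z], hence lies in [nb v];
   having [D.-1] members, this set fills [nb v :\ y], which contains [y']. *)
have nby : nb y :&: K = nb v :\ y.
  apply/eqP; rewrite eqEcard; apply/andP; split; last first.
    by rewrite -/(degin K y) dy; have := cardsD1 y (nb v); rewrite yv' dv; clear; lia.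
  apply/subsetP => w /setIP[]; rewrite inE => yw wK.
  have wy : w != y by apply: contraTneq yw => ->; rewrite adj_irr.
  rewrite in_setD1 wy /=; have [->//|wz] := eqVneq w z.
  have : w \in nb z.
    rewrite inE; apply: (nb_clique bK yK ncy dy).
    - by case: small; [right|left].
    - by rewrite !inE yz zK orbT.
    - by rewrite !inE yw wK orbT.
    - by rewrite eq_sym.
  rewrite -nbz !inE => /andP[_ /orP[/eqP wv|//]].
  by rewrite wv (negbTE vK) in wK.
have : y' \in nb v :\ y by rewrite in_setD1 eq_sym yy' y'v'.
by rewrite -nby !inE => /andP[].
Qed.

Lemma largest_bound : #|U :&: (v |: K)| <= 4 * edges_to P K.
Proof.
have blK := blU vU; have [bK _ _ _ _] := blK.
have e0 := blocked_edges blK; have eD := blocked_deficit blK.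
have dD := degin_le K v.
have low := low_bound bK.
have cover : #|U :&: (v |: K)| <= 1 + #|lowset K| + #|N|.
  have : U :&: (v |: K) \subset v |: (lowset K :|: N).
    apply/subsetP => x /setIP[xU]; rewrite !in_setU1 => /orP[->//|xK].
    rewrite in_setU; case xl: (x \in lowset K); rewrite ?orbT //=.
    by rewrite in_set xl inE xU xK orbT.
  move/subset_leq_card; rewrite cardsU1.
  have := cardsU (lowset K) N; case: (v \notin _); clear; lia.
(* With [e = edges_to P K > 0], the count is at most [2 + 2 * (deficitD K - D) <= 2 + 2 * e <= 4 *
   e]. *)
have [N1|N1] := leqP #|N| 1.
  by move: e0 eD dD low cover N1; clear; lia.
have sub : N \subset nb v :&: K.
  by apply/subsetP => x /nonlow_facts[_ xK _ xv _]; rewrite !inE adjC xv.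
have ND := subset_leq_card sub; rewrite -/(degin K v) in ND.
have d2 := leq_trans N1 ND.
have [y yN] : exists y, y \in N by apply/set0Pn; rewrite -card_gt0 ltnW.
have [y'] : exists y', y' \in N :\ y.
  by apply/set0Pn; rewrite -card_gt0; have := cardsD1 y N; rewrite yN; move: N1; clear; lia.
case/setD1P => y'y y'N; rewrite eq_sym in y'y.
have [D4|D4] := leqP 4 D; first by case: (largest_no_pair (or_intror D4) d2 yN y'N y'y).
have [e1|e1] := leqP (deficitD K) D.+1.
  by case: (largest_no_pair (or_introl e1) d2 yN y'N y'y).
(* What remains is [D = 3] with deficit at least 5. As [#|N| <= degin K v <= 3], the count is at
   most [2 * e + 4] for [e = edges_to P K], and [e >= 2]. *)
by move: e1 D4 e0 eD dD low cover ND; clear -D3; lia.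
Qed.

End LargestBlocked.

(** With [Kf v] largest, the members of [U] in [v |: Kf v] are charged to the edges into [Kf v]; the
    sets of all other members are disjoint from it, so no edge is charged twice. *)
Lemma blocked_count P U Kf :
  (forall u, u \in U -> blocked P u (Kf u)) ->
  #|U| <= 4 * edges_to P (\bigcup_(u in U) Kf u).
Proof.
have [n] := ubnP #|U|; elim: n U => // n IH U; rewrite ltnS => leUn blU.
have [->|/set0Pn[v0 v0U]] := eqVneq U set0; first by rewrite cards0.
case: (arg_maxnP (fun u => #|Kf u|) v0U) => v vU vmax.
have := largest_bound blU vU vmax; rewrite -(cardsID (v |: Kf v) U) => le1.
set U' := U :\: (v |: Kf v).
have subU : U' \subset U by apply: subsetDl.
have le2 : #|U'| <= 4 * edges_to P (\bigcup_(u in U') Kf u).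
  apply: IH => [|u /(subsetP subU)]; last exact: blU.
  apply: leq_trans leUn; apply: proper_card; apply/properP; split=> //.
  by exists v => //; rewrite !inE eqxx.
apply: leq_trans (leq_add le1 le2) _; rewrite -mulnDr leq_mul2l /=.
set W := \bigcup_(u in U) Kf u; set W' := \bigcup_(u in U') Kf u.
have KW : Kf v \subset W by apply: bigcup_sup.
have W'W : W' \subset W :\: Kf v.
  apply/bigcupsP => u; rewrite inE => /andP[uv uU].
  rewrite subsetD (bigcup_sup u) //=.
  exact: (blocked_disjoint (blU v vU) (blU u uU) (vmax u uU) uv).
rewrite {3}/edges_to (big_setID (Kf v)) /= (setIidPr KW) leq_add2l.
rewrite (big_setID W' (A := W :\: Kf v)) /= (setIidPr W'W).
exact: leq_addr.
Qed.

Section Lists.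
Variable L : G -> {fset C}.
Hypothesis cardL : forall v, #|` L v| = D.

(** All neighbours of a vertex of [K] lie in [K] or [S], and each one in [S] costs at most one
    colour, so the lists remain large enough. Tightness then turns these estimates into
    equalities. *)
Lemma rest_component f (S : {set G}) K :
  closed_in K (~: S) -> conn K -> ~ colorable K (rest_lists L f S) ->
  badable K /\ forall v, v \in K -> degin K v + degin S v = D /\ #|nb v| = D.
Proof.
move=> clK cK ncK; have [KS hK] := closed_inP _ _ clK.
have split_nb v : v \in K -> #|nb v| = degin K v + degin S v.
  move=> vK; rewrite -(cardsID K (nb v)); congr (_ + _).
  congr #|pred_of_set _|; apply/setP => x; rewrite !inE andbC; case vx: (adj v x) => //=.
  have [xK|xK] := boolP (x \in K).
    by apply/esym/negbTE; have := subsetP KS x xK; rewrite inE.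
  by apply/esym; apply: contraR xK => xS; apply: hK vK _ vx; rewrite inE.
have card_rest v : D <= #|` rest_lists L f S v| + degin S v.
  by rewrite -(cardL v); apply: card_avoid.
have bK : bad K (rest_lists L f S).
  split=> // v vK; have := card_rest v; have := degG v; rewrite (split_nb v vK).
  by clear; lia.
split; first by exists (rest_lists L f S).
move=> v vK; have := card_rest v; rewrite (bad_tight c0 bK vK) -(split_nb v vK).
by move=> h; split; apply/eqP; rewrite eqn_leq degG.
Qed.

Lemma coloring_exists : exists phi, is_coloring L phi.
Proof.
have [|nc] := pselect (colorable (~: set0) (rest_lists L (fun=> c0) set0)).
  case/extend_coloring => [v|u v|phi [h _]]; rewrite ?inE //.
  by exists phi.
have [K [clK cK ncK]] := uncolorable_component c0 nc.
have [bK degK] := rest_component clK cK ncK.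
have [v vK] := badable_lt bK.
have [<- _] := degK v vK; rewrite [degin set0 v]eq_card0 ?addn0 ?ltnn // => x.
by rewrite !inE andbF.
Qed.

Lemma edges_to_le P X : edges_to P X <= D * #|P|.
Proof.
rewrite /edges_to; under eq_bigr do rewrite -sum_adj.
rewrite exchange_big /= mulnC -sum_nat_const; apply: leq_sum => p _.
under eq_bigr do rewrite adjC.
by rewrite sum_adj degin_le.
Qed.

Lemma request_satisfied (r : G -> option C) : is_request L r ->
  exists phi, is_coloring L phi /\
    #|request_dom r| <= 6 * D * #|[set v in request_dom r | r v == Some (phi v)]|.
Proof.
move=> rL; pose sat (phi : G -> C) := [set v in request_dom r | r v == Some (phi v)].
pose Q n := `[< exists phi, is_coloring L phi /\ #|sat phi| = n >].
have exQ : exists n, Q n.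
  by have [phi h] := coloring_exists; exists #|sat phi|; apply/asboolP; exists phi.
have ubQ n : Q n -> n <= #|G| by move/asboolP => [phi [_ <-]]; apply: max_card.
case: (ex_maxnP exQ ubQ) => m /asboolP[phi [phiC <-]] maxphi.
exists phi; split=> //; rewrite -/(sat phi); set P := sat phi.
have [phiL phiP] := phiC.
pose U := [set v in request_dom r | (v \notin P) && (degin P v == 0)].
(* By maximality of [P], [phi] on [P] together with the requested colour at [u] does not extend. *)
have blocking u : exists K, u \in U -> blocked P u K.
  have [uU|uU] := boolP (u \in U); last by exists set0.
  move: uU; rewrite inE => /and3P[]; rewrite inE; case rc: (r u) => [c|//] _ uP /eqP Pu.
  pose f v := if v == u then c else phi v.
  have fP v : v \in P -> f v = phi v.
    by rewrite /f; case: eqVneq => // ->; rewrite (negbTE uP).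
  have fu : f u = c by rewrite /f eqxx.
  have noPu v : v \in P -> adj u v -> False.
    by move=> vP /(degin_pos vP); rewrite Pu.
  have nc : ~ colorable (~: (u |: P)) (rest_lists L f (u |: P)).
    case/extend_coloring => [v|v w|psi [psiC psiE]].
    - rewrite in_setU1 => /orP[/eqP->|vP]; first by rewrite fu; apply: rL.
      by rewrite fP.
    - rewrite !in_setU1 => /orP[/eqP->|vP] /orP[/eqP->|wP] vw.
      + by rewrite adj_irr in vw.
      + by case: (noPu w wP vw).
      + by case: (noPu v vP); rewrite adjC.
      + by rewrite !fP // phiP.
    have : Q #|sat psi| by apply/asboolP; exists psi.
    move/maxphi; apply/negP; rewrite -ltnNge.
    have -> : #|P|.+1 = #|u |: P| by rewrite cardsU1 uP.
    apply/subset_leq_card/subsetP => v vS; rewrite !inE psiE //.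
    move: vS; rewrite in_setU1 => /orP[/eqP->|vP]; first by rewrite fu rc eqxx.
    by rewrite fP //; move: vP; rewrite !inE.
  have [K [clK cK ncK]] := uncolorable_component c0 nc.
  have [bK degK] := rest_component clK cK ncK.
  have KS v : v \in K -> v != u /\ v \notin P.
    case/closed_inP: clK => /subsetP sub _ /sub.
    by rewrite in_setC in_setU1 negb_or => /andP[].
  exists K => _; split=> //.
  - by split=> //; apply/negP => /KS[]; rewrite eqxx.
  - suff <- : ~: (u |: P) = ~: P :\ u by [].
    by apply/setP => v; rewrite in_setC in_setU1 in_setD1 in_setC negb_or.
  - by move=> v /degK[].
  (* Without a neighbour of [u] in [K], [phi] itself would colour [K] from the remaining lists. *)
  rewrite lt0n; apply/negP => /eqP uK; apply: ncK; exists phi.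
  split=> [v vK|v w _ _]; last exact: phiP.
  rewrite in_avoid phiL; apply/forall_inP => w; rewrite in_setI in_setU1 inE => /andP[vw].
  case/orP => [/eqP wu|wP]; last by rewrite fP // eq_sym phiP.
  by have := @degin_pos G K u v vK; rewrite uK -wu adjC vw => /(_ isT).
have [Kf blU] := fin_all_exists blocking.
have leU := blocked_count blU.
have {leU} leU := leq_trans leU (leq_mul (leqnn 4) (edges_to_le P _)).
pose N := [set v | 0 < degin P v].
have leN : #|N| <= D * #|P|.
  apply: leq_trans (edges_to_le P N); rewrite /edges_to -sum1_card.
  by apply: leq_sum => v; rewrite inE.
have : request_dom r \subset P :|: N :|: U.
  apply/subsetP => v vD; rewrite in_setU in_setU /N /U in_set in_set vD lt0n /=.
  by case: (v \in P); case: (degin P v == 0).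
move/subset_leq_card => le; apply: leq_trans le _.
have := cardsU (P :|: N) U; have := cardsU P N; move: leN leU.
by clear -D3; nia.
Qed.

End Lists.

(** * Weighted requests *)

(* Distance at most 3: an edge [uv] is the walk [u v u v]. *)
Definition close u v :=
  [|| u == v, [exists a, adj u a && adj a v]
   | [exists a, exists b, [&& adj u a, adj a b & adj b v]]].

Lemma closeC u v : close u v = close v u.
Proof.
suff imp x y : close x y -> close y x by apply/idP/idP; apply: imp.
case/or3P => [/eqP->|/existsP[a /andP[xa ay]]|/existsP[a /existsP[b /and3P[xa ab by_]]]].
- by rewrite /close eqxx.
- by apply/or3P/Or32/existsP; exists a; rewrite adjC ay adjC xa.
- apply/or3P/Or33/existsP; exists b; apply/existsP; exists a.
  by rewrite adjC by_ adjC ab adjC xa.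
Qed.

Lemma adj_close u v : adj u v -> close u v.
Proof.
move=> uv; apply/or3P/Or33/existsP; exists v; apply/existsP; exists u.
by rewrite uv adjC uv.
Qed.

(** Counting walks that do not turn back gives at most [1 + D * (1 + (D - 1) * D) <= D ^ 3]. *)
Lemma card_close u : #|[set v | close u v]| <= D ^ 3.
Proof.
pose far (a b : G) := b |: (nb b :\ a); pose near (a : G) := a |: \bigcup_(b in nb a :\ u) far a b.
have card_nb1 (a b : G) : adj a b -> #|nb a :\ b| <= D.-1.
  by move=> ab; have := degG a; rewrite (cardsD1 b) inE ab; clear; lia.
have card1 (a : G) (X : {set G}) : #|a |: X| <= 1 + #|X|.
  by rewrite cardsU1; case: (a \notin X).
have sub : [set v | close u v] \subset u |: \bigcup_(a in nb u) near a.
  apply/subsetP => v; rewrite inE => /or3P[/eqP->|/existsP[a /andP[ua av]]|];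
    first by rewrite setU11.
    have [->|vu] := eqVneq v u; first by rewrite setU11.
    rewrite in_setU1 (negbTE vu) /=; apply/bigcupP; exists a; first by rewrite inE.
    rewrite in_setU1; apply/orP; right; apply/bigcupP; exists v; first by rewrite !inE vu.
    by rewrite setU11.
  case/existsP => a /existsP[b /and3P[ua ab bv]].
  rewrite in_setU1; apply/orP; right; have [bu|bu] := eqVneq b u.
    by apply/bigcupP; exists v; [rewrite inE -bu | rewrite setU11].
  apply/bigcupP; exists a; first by rewrite inE.
  have [->|va] := eqVneq v a; first by rewrite setU11.
  rewrite in_setU1 (negbTE va) /=; apply/bigcupP; exists b; first by rewrite !inE bu.
  by rewrite !inE va bv orbT.
have cfar (a b : G) : adj a b -> #|far a b| <= D.
  move=> ab; apply: leq_trans (card1 _ _) _; have := card_nb1 b a.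
  by rewrite adjC ab => /(_ isT); clear -D3; lia.
have cnear a : a \in nb u -> #|near a| <= 1 + D.-1 * D.
  rewrite inE => ua; apply: leq_trans (card1 _ _) _; rewrite leq_add2l.
  apply: leq_trans (card_bigcup_le (m := D) _) _.
    by move=> b; rewrite !inE => /andP[_ ab]; apply: cfar.
  by rewrite leq_mul2r card_nb1 ?orbT // adjC.
apply: leq_trans (subset_leq_card sub) _; apply: leq_trans (card1 _ _) _.
apply: leq_trans (leq_add (leqnn 1) (card_bigcup_le cnear)) _.
have := degG u; rewrite !expnS expn0 muln1; clear -D3; case: D D3 => [//|d /= d2] le.
apply: leq_trans (leq_add (leqnn 1) (leq_mul le (leqnn _))) _; nia.
Qed.

Definition scattered (S : {set G}) := {in S &, forall u v, close u v -> u = v}.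

Section Scattered.
Variables (L : G -> {fset C}) (f : G -> C) (S : {set G}).
Hypothesis cardL : forall v, #|` L v| = D.
Hypothesis scS : scattered S.
Hypothesis fL : forall v, f v \in L v.

Definition obstruction K :=
  [/\ closed_in K (~: S), conn K & ~ colorable K (rest_lists L f S)].

(* In the intended case [s] sees all of an end block [A] but its attachment
   vertex, so [s |: A] is [K_(D+1)] minus an edge: a component that contains it is
   always colourable. *)
Definition twin_owner K s :=
  [/\ s \in S, D.-1 <= degin K s
    & exists A, [/\ A \subset K, conn (s |: A) & ~ badable (s |: A)]].

Lemma scattered_degin v : degin S v <= 1.
Proof.
rewrite leqNgt; apply/negP => /card_gt1P[x [y []]].
rewrite !inE => /andP[vx xS] /andP[vy yS] /eqP; apply; apply: scS => //.
by apply/or3P/Or32/existsP; exists v; rewrite adjC vx.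
Qed.

(** Neighbours in [S] of two adjacent vertices are at distance at most 3, hence equal; connectedness
    spreads this owner over [A]. *)
Lemma common_owner A : conn A -> (forall v, v \in A -> 0 < degin S v) ->
  exists2 s, s \in S & A \subset nb s.
Proof.
move=> cA dA; have [x xA] := conn_neq0 cA.
have nbS v : v \in A -> exists s, s \in S /\ adj v s.
  by move/dA; rewrite card_gt0 => /set0Pn[s]; rewrite !inE => /andP[vs sS]; exists s.
have [s [sS xs]] := nbS x xA; exists s => //.
have clA : closed_in (A :&: nb s) A.
  apply/closed_inP; split; first exact: subsetIl.
  move=> a b; rewrite !inE => /andP[aA sa] bA ab; rewrite bA /=.
  have [s' [s'S bs']] := nbS b bA; suff -> : s = s' by rewrite adjC.
  apply: scS => //; apply/or3P/Or33/existsP; exists a; apply/existsP; exists b.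
  by rewrite sa ab bs'.
by rewrite -(conn_closed cA clA (x := x)) ?subsetIr // !inE xA adjC.
Qed.

(** Away from [z], a vertex of the block has degree [d < D] in [K] and at most one neighbour in [S],
    which forces [d = D.-1] and exactly one such neighbour. *)
Lemma end_owner K A B z :
  badable K -> (forall v, v \in K -> degin K v + degin S v = D) ->
  K \subset ~: S -> sep K A B z -> nocut A ->
  exists s, [/\ s \in S, A :\ z \subset nb s, D.-1 <= #|A :\ z|,
    conn (s |: A) & ~ badable (s |: A)].
Proof.
move=> bK degK KS h ncA; have [bA _] := sep_badable c0 bK h.
have [[_ _ [cA _]] [A1 _] _] := h.
have [d [dD ltd dA defA]] := block_regular bA ncA.
have cardA := cardsD1 z A; rewrite (sep_zA h) in cardA.
have degS v : v \in A :\ z -> d + degin S v = D.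
  rewrite !inE => /andP[vz vA]; rewrite -(dA v vA) -(sep_degA h vA vz).
  exact/degK/(subsetP (sep_subA h)).
have [x xAz] : exists x, x \in A :\ z.
  by apply/set0Pn; rewrite -card_gt0; move: cardA A1; clear; lia.
have dE : d = D.-1.
  by have := scattered_degin x; have := degS x xAz; move: dD; clear; lia.
have cAz := noncut_conn cA A1 (forall_inP ncA _ (sep_zA h)).
have [v /degS|s sS sub] := common_owner cAz; first by move: dE dD; clear; lia.
have xA : x \in A by have /setD1P[] := xAz.
have sx : adj s x by have := subsetP sub _ xAz; rewrite inE.
have sA : s \notin A.
  apply/negP => /(subsetP (sep_subA h))/(subsetP KS).
  by rewrite inE sS.
exists s; split=> //; first by move: cardA ltd; rewrite dE; clear; lia.
  by apply: connU1 cA xA _; rewrite adjC.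
(* The deficit of [A] is [#|A| >= D]; adding [s] with at least [#|A| - 1] neighbours makes it at
   most [D + 2 - #|A| <= 2], below [D]. *)
move=> bsA; have := deficit_ge bsA.
have : #|A :\ z| <= degin A s.
  by apply: subset_leq_card; rewrite subsetI sub subD1set.
have := deficit_add1 sA; rewrite defA dE; move: cardA ltd; rewrite dE.
by clear -D3; case: D D3 => //= d' d2; rewrite subSnn muln1; lia.
Qed.

Lemma obstruction_facts K : obstruction K ->
  [/\ badable K, K \subset ~: S & forall v, v \in K -> degin K v + degin S v = D].
Proof.
case=> clK cK ncK; have [bK degK] := rest_component cardL clK cK ncK.
by split=> [||v /degK[]//] //; case/closed_inP: clK.
Qed.

(** End blocks on opposite sides of a cut vertex have different owners, since a common one would
    have [2 * (D - 1) > D] neighbours. Without cut vertices one [s] would own all of [K], and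
    [degin K s] would equal the deficit. *)
Lemma two_owners K : obstruction K ->
  exists s, [/\ twin_owner K s.1, twin_owner K s.2 & s.1 != s.2].
Proof.
move=> oK; have [bK KS degK] := obstruction_facts oK.
have cK := badable_conn bK.
have [ncK|[A0 [B0 [z0 h0]]]] := nocut_or_sep cK.
  have [d [dD ltd dQ defQ]] := block_regular bK ncK.
  have dE v : v \in K -> degin S v = 1 /\ d = D.-1.
    move=> vK; have := degK v vK; rewrite dQ //; have := scattered_degin v.
    by move: dD; clear; lia.
  have [v /dE[->]//|s sS sub] := common_owner cK.
  have [x /dE[_ ed]] := conn_neq0 cK.
  have sK : s \notin K by apply/negP => /(subsetP KS); rewrite inE sS.
  have := degin_lt_deficit bK sK.
  rewrite /degin (setIidPr sub) defQ ed.
  by clear -D3; case: D D3 => //= d' _; rewrite subSnn muln1 ltnn.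
have [A1 [B1 [z1 [h1 nc1 sub1]]]] := end_block h0.
have [A2 [B2 [z2 [h2 nc2 sub2]]]] := end_block (sepC h0).
have [s1 [s1S n1 c1 cc1 nb1]] := end_owner bK degK KS h1 nc1.
have [s2 [s2S n2 c2 cc2 nb2]] := end_owner bK degK KS h2 nc2.
have AK A B z : sep K A B z -> A :\ z \subset K.
  by move=> h; apply: subset_trans (subD1set _ _) (sep_subA h).
have deg1 : D.-1 <= degin K s1.
  by apply: leq_trans c1 _; apply: subset_leq_card; rewrite subsetI n1 (AK _ _ _ h1).
have deg2 : D.-1 <= degin K s2.
  by apply: leq_trans c2 _; apply: subset_leq_card; rewrite subsetI n2 (AK _ _ _ h2).
exists (s1, s2); split=> /=.
- by split=> //; exists A1; split=> //; apply: sep_subA h1.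
- by split=> //; exists A2; split=> //; apply: sep_subA h2.
apply/negP => /eqP e; rewrite -e in n2.
have dis : (A1 :\ z1) :&: (A2 :\ z2) = set0.
  apply/setP => x; rewrite [RHS]inE; apply/negP => /setIP[/(subsetP sub1) x1 /(subsetP sub2) x2].
  move: x1 x2 => /setD1P[xz xA] /setD1P[_ xB].
  by rewrite (sep_inAB h0 xA xB) eqxx in xz.
have : (A1 :\ z1) :|: (A2 :\ z2) \subset nb s1 by rewrite subUset n1 n2.
move/subset_leq_card; rewrite cardsU dis cards0; have := degG s1.
by move: c1 c2; clear -D3; lia.
Qed.

Lemma obstruction_unique K K' s : obstruction K -> obstruction K' ->
  D.-1 <= degin K s -> D.-1 <= degin K' s -> K = K'.
Proof.
move=> [clK cK _] [clK' cK' _] d1 d2.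
have [/existsP[x /andP[xK xK']]|/existsPn h] := boolP [exists x, (x \in K) && (x \in K')].
  have [KS _] := closed_inP _ _ clK; have [KS' _] := closed_inP _ _ clK'.
  apply/eqP; rewrite eqEsubset (conn_sub_closed cK KS clK' xK xK').
  exact: (conn_sub_closed cK' KS' clK xK' xK).
have dis : (nb s :&: K) :&: (nb s :&: K') = set0.
  apply/setP => x; rewrite !inE; have := h x.
  by case: (x \in K) => /= [/negbTE->|_]; rewrite ?andbF.
have : (nb s :&: K) :|: (nb s :&: K') \subset nb s by rewrite subUset !subsetIl.
move/subset_leq_card; rewrite cardsU dis cards0; have := degG s.
by move: d1 d2; rewrite /degin; clear -D3; lia.
Qed.

Definition obstructions := [set K | `[< obstruction K >]].

(** An uncolourable component [K'] of [G - S'] cannot contain an uncoloured owner: it would swallow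
    its obstruction and thus a set that is not badable. So [K'] is itself an obstruction, yet it
    must contain its uncoloured neighbour [t K']. *)
Lemma drop_owners (t : {set G} -> G) :
  (forall K, obstruction K -> twin_owner K (t K)) ->
  exists phi, is_coloring L phi /\
    forall v, v \in S :\: [set t K | K in obstructions] -> phi v = f v.
Proof.
move=> ht; set T := [set t K | K in obstructions]; set S' := S :\: T.
apply: extend_coloring => [v _|u v /setDP[uS _] /setDP[vS _] uv|]; first exact: fL.
  by have := scS uS vS (adj_close uv) => e; rewrite e adj_irr in uv.
case: (pselect (colorable (~: S') (rest_lists L f S'))) => // nc; exfalso.
have [K' [clK' cK' ncK']] := uncolorable_component c0 nc.
have [bK' _] := rest_component cardL clK' cK' ncK'.
have [K'S cl'] := closed_inP _ _ clK'.
have SS : ~: S \subset ~: S' by rewrite setCS subsetDl.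
have TK' K : obstruction K -> t K \in T.
  by move=> oK; apply/imsetP; exists K; rewrite // inE; apply/asboolP.
have tS' K : obstruction K -> t K \in ~: S' by move=> oK; rewrite !inE (TK' K oK).
have nbt K : obstruction K -> exists2 x, x \in K & adj (t K) x.
  move/ht => [_ d _]; have : 0 < degin K (t K) by move: d; clear -D3; lia.
  by rewrite card_gt0 => /set0Pn[x]; rewrite !inE => /andP[]; exists x.
have noT s : s \in T -> s \notin K'.
  case/imsetP => K; rewrite inE => /asboolP oK ->; apply/negP => sK'.
  have [_ _ [A [AK cA]]] := ht K oK; apply.
  have [x xK sx] := nbt K oK; have [clK cK _] := oK.
  have [KS _] := closed_inP _ _ clK; have KS' := subset_trans KS SS.
  have xK' : x \in K' by apply: cl' sK' (subsetP KS' _ xK) sx.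
  have KK' := conn_sub_closed cK KS' clK' xK xK'.
  by apply: (badable_sub c0 bK' _ cA); rewrite subUset sub1set sK' (subset_trans AK).
have K'S0 : K' \subset ~: S.
  apply/subsetP => x xK'; have := subsetP K'S x xK'; rewrite !inE negb_and negbK.
  by case/orP => // /noT; rewrite xK'.
have oK' : obstruction K'.
  split=> //.
    apply/closed_inP; split=> // a b aK' bS; apply: cl' => //.
    exact: (subsetP SS).
  case=> phi [phiL phiP]; apply: ncK'; exists phi; split=> // v vK'.
  have := phiL v vK'; rewrite !in_avoid => /andP[-> /forall_inP h].
  apply/forall_inP => s /setIP[vs /setDP[sS _]]; apply: h; by rewrite inE vs.
have [x xK' tx] := nbt K' oK'.
have /negP[] := noT _ (TK' K' oK'); apply: cl' xK' (tS' K' oK') _.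
by rewrite adjC.
Qed.

End Scattered.

Section Weights.
Variables (R : realType).
Local Open Scope ring_scope.

(** A heaviest vertex enters [S], and the at most [D ^ 3] vertices close to it, none heavier, are
    discarded. *)
Lemma scattered_heavy (g : G -> R) (U : {set G}) : (forall v, 0 <= g v) ->
  exists S, [/\ scattered S, S \subset U &
    \sum_(v in U) g v <= (D ^ 3)%:R * \sum_(v in S) g v].
Proof.
move=> g0; have [n] := ubnP #|U|; elim: n U => // n IH U; rewrite ltnS => leUn.
have [->|/set0Pn[v0 v0U]] := eqVneq U set0.
  exists set0; split; [by move=> u v; rewrite inE | exact: sub0set |].
  by rewrite !big_set0 mulr0.
case: (Order.TotalTheory.arg_maxP g v0U) => v vU' vmax.
have vU : v \in U by exact: vU'.
set B := [set w | close v w]; have vB : v \in B by rewrite inE /close eqxx.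
have [|S [scS SU le]] := IH (U :\: B).
  apply: leq_trans leUn; apply: proper_card; apply/properP; split; first exact: subsetDl.
  by exists v => //; rewrite !inE /close eqxx.
have vS : v \notin S by apply/negP => /(subsetP SU); rewrite inE vB.
have far u : u \in S -> ~~ close v u.
  by move/(subsetP SU); rewrite !inE => /andP[].
exists (v |: S); split.
- move=> x y /setU1P[->|xS] /setU1P[->|yS] // cxy; last exact: scS.
    by have := far y yS; rewrite cxy.
  by have := far x xS; rewrite closeC cxy.
- by rewrite subUset sub1set vU (subset_trans SU) ?subsetDl.
rewrite big_setU1 //= mulrDr (big_setID B) /= lerD //.
apply: (@le_trans _ _ (\sum_(w in U :&: B) g v)).
  by apply: ler_sum => w /setIP[wU _]; apply: vmax.
rewrite sumr_const -[leLHS]mulr_natl ler_wpM2r // ler_nat.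
apply: leq_trans (card_close v); exact/subset_leq_card/subsetIr.
Qed.

Lemma weighted_request_satisfied (L : G -> {fset C}) (w : G -> C -> R) :
  (forall v, #|` L v| = D) -> is_weighted_request L w ->
  exists phi, is_coloring L phi /\
    \sum_v \sum_(c <- L v) w v c <= (2 * D ^ 4)%:R * \sum_v w v (phi v).
Proof.
move=> cardL w0.
have best v : exists c, c \in L v /\ \sum_(x <- L v) w v x <= D%:R * w v c.
  have [|c cL le] := @best_in_seq R C (L v) (w v); last by exists c; rewrite -[in D%:R](cardL v).
  by rewrite -size_eq0 (cardL v) -lt0n; apply: ltn_trans D3.
have [f fP] := fin_all_exists best.
have fL v : f v \in L v by case: (fP v).
pose g v := w v (f v); have g0 v : 0 <= g v by apply: w0.
have [S [scS _ heavy]] := scattered_heavy [set: G] g0.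
have [x0 _] := conn_neq0 connG.
have pair K : exists s : G * G, obstruction L f S K ->
    [/\ twin_owner S K s.1, twin_owner S K s.2 & s.1 != s.2].
  have [oK|noK] := pselect (obstruction L f S K); last by exists (x0, x0).
  by have [s hs] := two_owners cardL scS oK; exists s.
have [t tP] := fin_all_exists pair.
pose T i := [set (if i then (t K).1 else (t K).2) | K in obstructions L f S].
have owner (i : bool) K : obstruction L f S K ->
    twin_owner S K (if i then (t K).1 else (t K).2).
  by move=> oK; have [h1 h2 _] := tP K oK; case: i.
have TS : T true \subset S.
  apply/subsetP => s /imsetP[K]; rewrite inE => /asboolP oK ->.
  by have [] := owner true K oK.
(* A vertex in both images would, by [obstruction_unique], be the first and the second owner of the
   same [K]. *)
have dis : [disjoint T true & T false].
  rewrite disjoint_subset; apply/subsetP => s /imsetP[K]; rewrite inE => /asboolP oK es.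
  rewrite inE; apply/imsetP => -[K']; rewrite inE => /asboolP oK' es'.
  have [_ d1 _] := owner true K oK; have [_ d2 _] := owner false K' oK'.
  rewrite -es in d1; rewrite -es' in d2.
  have eK := obstruction_unique oK oK' d1 d2.
  by have [_ _] := tP K oK; rewrite -es eK -es' eqxx.
have [i heavy'] : exists i, \sum_(v in S) g v <= 2 * \sum_(v in S :\: T i) g v.
  by case: (half_weight g0 TS dis) => h; [exists true | exists false].
have [phi [phiC phiE]] := drop_owners cardL scS fL (owner i).
exists phi; split=> //.
have le1 : \sum_v \sum_(c <- L v) w v c <= D%:R * \sum_v g v.
  by rewrite mulr_sumr; apply: ler_sum => v _; case: (fP v).
have le2 : \sum_(v in S :\: T i) g v <= \sum_v w v (phi v).
  rewrite [leRHS](bigID (mem (S :\: T i))) /=.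
  rewrite (eq_bigr (fun v => w v (phi v))) => [|v /phiE->//].
  by rewrite lerDl sumr_ge0 // => v _; apply: w0; case: phiC.
have setTE : \sum_(v in [set: G]) g v = \sum_v g v by apply: eq_bigl => v; rewrite inE.
rewrite setTE in heavy.
apply: le_trans le1 _; apply: le_trans (ler_wpM2l (ler0n _ D) heavy) _.
(* The factor [D] comes from keeping one colour per vertex, [D ^ 3] from scattering, and 2 from
   dropping owners. *)
have -> : (2 * D ^ 4)%:R = D%:R * (D ^ 3)%:R * 2 :> R.
  by rewrite -!natrM -expnS mulnC.
rewrite mulrA -[leRHS]mulrA ler_wpM2l ?mulr_ge0 ?ler0n //.
by apply: le_trans heavy' _; rewrite ler_wpM2l.
Qed.

End Weights.

End Main.

(** * Transfer to the graph notions of the statement, and the theorem *)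

Lemma connected_conn (G : sgraph) : connected_graph G -> conn [set: G].
Proof.
case=> /card_gt0P[x _] con; apply: (@conn_intro _ _ x); first by rewrite inE.
move=> A /closed_inP[_ cl] xA; apply/subsetP => y _.
have clA : closed (@adj G) (mem A).
  move=> a b ab; apply/idP/idP => [aA|bA]; first exact: (cl a b).
  by apply: (cl b a) => //; rewrite adjC.
by have := closed_connect clA (con x y); rewrite xA => <-.
Qed.

Lemma full_graph_iso (G : sgraph) n :
  #|G| = n.+1 -> (forall v : G, #|nb v| = n) -> graph_iso G (complete_graph n.+1).
Proof.
move=> cardG degG; exists (fun v => cast_ord cardG (enum_rank v)); split.
  exists (fun i => enum_val (cast_ord (esym cardG) i)) => [v|i].
    by rewrite cast_ordK enum_rankK.
  by rewrite enum_valK cast_ordKV.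
move=> u v /=; rewrite (inj_eq (@cast_ord_inj _ _ _)) (inj_eq enum_rank_inj).
have [->|uv] := eqVneq u v; first by rewrite adj_irr.
apply/esym; apply: (@full_adj G [set: G]); rewrite ?inE //.
by rewrite /degin setIT degG cardsT cardG.
Qed.

Local Open Scope ring_scope.

Theorem theorem2p4 (R : realType) (G : sgraph) (Delta : nat)
    (hconn : connected_graph G) (hDelta : max_degree G = Delta)
    (hDelta3 : (3 <= Delta)%N)
    (hK : ~ graph_iso G (complete_graph Delta.+1)) :
  flexibly_choosable (1 / (6 * Delta%:R) : R) Delta G /\
  weighted_flexibly_choosable (1 / (2 * Delta%:R ^+ 4) : R) Delta G.
Proof.
have connG := connected_conn hconn.
have degG (v : G) : (#|nb v| <= Delta)%N.
  by rewrite -hDelta; apply: (leq_bigmax (F := fun v : G => degree v)).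
have notK : ~ (#|G| = Delta.+1 /\ forall v : G, #|nb v| = Delta).
  by case=> cardG degD; apply: hK; apply: full_graph_iso.
have D0 : 0 < Delta%:R :> R by rewrite ltr0n; apply: leq_trans hDelta3.
(* The type [C] could be empty a priori; a list at some vertex supplies the default colour [c0]. *)
have color (C : choiceType) (L : list_assignment G C) :
    (forall v, #|` L v| = Delta) -> exists c : C, True.
  move=> cardL; have [x _] := conn_neq0 connG.
  have /fset0Pn[c _] : L x != fset0 by rewrite -cardfs_gt0 cardL; apply: leq_trans hDelta3.
  by exists c.
split=> C L cardL; have [c0 _] := color C L cardL.
  move=> r rL.
  have [phi [phiC le]] := request_satisfied c0 hDelta3 degG connG notK cardL rL.
  exists phi; split=> //.
  rewrite mul1r mulrC ler_pdivrMr ?mulr_gt0 // mulrC -!natrM ler_nat.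
  exact: le.
move=> w w0.
have [phi [phiC le]] := weighted_request_satisfied c0 hDelta3 degG connG notK cardL w0.
exists phi; split=> //.
rewrite mul1r mulrC ler_pdivrMr ?mulr_gt0 ?exprn_gt0 // mulrC.
by rewrite -natrX -natrM.
Qed.
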